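(* For all integers $r \geq 2$ and all $\varepsilon \in (0,1)$, there exists $d_0 \in \mathbb{N}$ such that the following holds for all $d \geq d_0$. There exists $n_0 \in \mathbb{N}$ such that for any integer $n \geq n_0$, with $p = d/n^{r-1}$ and $H \sim \mathcal{H}(r,n,p)$, we have \[(1 - \varepsilon)\left(\frac{r-1}{r}\cdot\frac{d}{\log d}\right)^{\frac{1}{r-1}} \,\leq\, \chi_b(H) \,\leq\, (1 + \varepsilon)\left(\frac{r-1}{r}\cdot\frac{d}{\log d}\right)^{\frac{1}{r-1}}\] with high probability.
   Context: An $r$-uniform hypergraph $H=(V,E)$ (every edge is an $r$-element subset of $V$) is $r$-partite, with partition $V = V_1\cup\cdots\cup V_r$ into disjoint parts, if $|e\cap V_i|=1$ for every $e\in E$ and $i \in [r]$. A set $I\subseteq V$ is independent if it contains no edge of $H$ as a subset; an independent set $I$ is balanced if $|I\cap V_i| = |I\cap V_j|$ for all $i,j\in[r]$. A proper $q$-coloring is a function $\phi: V\to[q]$ such that $\phi^{-1}(i)$ is independent for each $i\in[q]$; it is balanced if every color class $\phi^{-1}(i)$ is a balanced independent set. The balanced chromatic number $\chi_b(H)$ is the minimum $q$ such that $H$ has a balanced proper $q$-coloring ($\chi_b(H)=\infty$ if there is none). The random hypergraph $\mathcal{H}(r,n,p)$, for integers $n\ge r\ge 2$ and $p\in[0,1]$, is the $r$-uniform $r$-partite hypergraph on vertex set $[n]\times[r]$ with parts $V_i=[n]\times\{i\}$, where each $e\in V_1\times\cdots\times V_r$ (viewed as an $r$-element set) is included as an edge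 independently with probability $p$. ''With high probability'' means with probability at least $1-1/\mathrm{poly}(n)$, i.e. at least $1-n^{-c}$ for some constant $c>0$ not depending on $n$. $\log$ is the natural logarithm. *)

(* Defs.v *)
From HB Require Import structures.
From mathcomp Require Import all_boot all_order all_algebra.
From mathcomp Require Import all_classical all_reals all_analysis.

Set Implicit Arguments.
Unset Strict Implicit.
Unset Printing Implicit Defensive.

Import Order.TTheory GRing.Theory Num.Theory.
Local Open Scope ring_scope.

(* A hypergraph on V is given by its edge set E : {set {set V}}, and an
   r-partition of V by the family of its parts Vs : 'I_r -> {set V}. *)

Definition partite (V : finType) (r : nat) (Vs : 'I_r -> {set V})
    (E : {set {set V}}) : bool :=
  [forall e in E, forall i : 'I_r, #|e :&: Vs i| == 1%N].

Definition independent (V : finType) (E : {set {set V}}) (I : {set V}) : bool :=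
  [forall e in E, ~~ (e \subset I)].

Definition balanced (V : finType) (r : nat) (Vs : 'I_r -> {set V})
    (I : {set V}) : bool :=
  [forall i : 'I_r, forall j : 'I_r, #|I :&: Vs i| == #|I :&: Vs j|].

Definition proper_coloring (V : finType) (E : {set {set V}}) (q : nat)
    (phi : {ffun V -> 'I_q}) : bool :=
  [forall c : 'I_q, independent E (phi @^-1: [set c])].

Definition balanced_coloring (V : finType) (r : nat) (Vs : 'I_r -> {set V})
    (E : {set {set V}}) (q : nat) (phi : {ffun V -> 'I_q}) : bool :=
  proper_coloring E phi && [forall c : 'I_q, balanced Vs (phi @^-1: [set c])].

Definition balanced_colorable (V : finType) (r : nat) (Vs : 'I_r -> {set V})
    (E : {set {set V}}) (q : nat) : bool :=
  [exists phi : {ffun V -> 'I_q}, balanced_coloring Vs E phi].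

Definition balanced_chromatic_number (R : realType) (V : finType) (r : nat)
    (Vs : 'I_r -> {set V}) (E : {set {set V}}) : \bar R :=
  match pselect (exists q, balanced_colorable Vs E q) with
  | left colorable => ((ex_minn colorable)%:R)%:E
  | right _ => +oo%E
  end.

Definition part (r n : nat) (i : 'I_r) : {set 'I_n * 'I_r} :=
  [set v | v.2 == i].

(* The elements of V_1 x ... x V_r, viewed as r-element sets. *)
Definition transversals (r n : nat) : {set {set 'I_n * 'I_r}} :=
  [set [set (f i, i) | i : 'I_r] | f : {ffun 'I_r -> 'I_n}].

(* The law of H(r, n, p), as a weight on the edge sets E \subset transversals:
   the product of the Bernoulli(p) weights of the indicators of e \in E. *)
Definition hypergraph_weight (R : realType) (r n : nat) (p : R)
    (E : {set {set 'I_n * 'I_r}}) : R :=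
  \prod_(e in transversals r n) (if e \in E then p else 1 - p).

Definition hypergraph_Pr (R : realType) (r n : nat) (p : R)
    (event : {set {set 'I_n * 'I_r}} -> bool) : R :=
  \sum_(E in powerset (transversals r n) | event E) hypergraph_weight p E.

Lemma transversals_partite (r n : nat) : partite (@part r n) (transversals r n).
Proof.
apply/forall_inP => e /imsetP[f _ ->]; apply/forallP => i.
apply/cards1P; exists (f i, i); apply/setP => -[a b]; rewrite !inE /=.
apply/andP/eqP => [[/imsetP[j _ [-> ->]] /eqP ->] //|[-> ->]].
by split=> //; apply/imsetP; exists i.
Qed.

Lemma card_transversal (r n : nat) (e : {set 'I_n * 'I_r}) :
  e \in transversals r n -> #|e| = r.
Proof.
by case/imsetP => f _ ->; rewrite card_imset ?card_ord// => i j [].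
Qed.

(* The edges are mutually independent, each present with probability p. For
   A = set0 this says that the total mass is 1. *)
Lemma hypergraph_Pr_sub (R : realType) (r n : nat) (p : R)
    (A : {set {set 'I_n * 'I_r}}) :
  A \subset transversals r n ->
  hypergraph_Pr p (fun E => A \subset E) = p ^+ #|A|.
Proof.
move=> sAT; set T := transversals r n.
pose F e : R := if e \in T then p else 0.
pose G e : R := if e \in A then 0 else if e \in T then 1 - p else 1.
transitivity (\prod_e (F e + G e)).
  rewrite bigA_distr /hypergraph_Pr big_mkcond [RHS]big_mkcond /=.
  apply: eq_bigr => J _; rewrite powersetE.
  have [sJT|/subsetPn[e eJ eT]] := boolP (J \subset T); last first.
    by rewrite /= (bigD1 e)//= eJ /F (negbTE eT) mul0r.
  have [sAJ|/subsetPn[e eA eJ]] := boolP (A \subset J); last first.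
    by rewrite /= (bigD1 e)//= (negbTE eJ) /G eA mul0r.
  rewrite /hypergraph_weight big_mkcond /=; apply: eq_bigr => e _.
  rewrite /F /G; case: ifP => eT; case: ifP => eJ //.
  - by case: ifP => // /(fintype.subsetP sAJ); rewrite eJ.
  - by move/(fintype.subsetP sJT): eJ; rewrite -/T eT.
  - by case: ifP => // /(fintype.subsetP sAT); rewrite -/T eT.
rewrite -prodr_const [RHS]big_mkcond; apply: eq_bigr => e _.
rewrite /F /G; have [eA|_] := boolP (e \in A).
  by rewrite (fintype.subsetP sAT _ eA) /= addr0.
by case: ifP => _; rewrite ?add0r // addrC subrK.
Qed.

(* Main.v *)
(* Write x for ((r - 1) / r * d / ln d)^(1 / (r - 1)).

   Lower bound: first moment. A coloring with too few colors has a class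
   with at least k = n / ((1 - eps) x) vertices in every part, and the expected
   number of edge-free boxes of side k is exponentially small.

   Upper bound: let q be slightly above x. Count the proper colorings in which
   every part is colored with the same nearly equal class sizes. In the second
   moment the overlap term sum_{j,l} prod_i m^i_{jl} is at most
   (1/r) sum_i sum_{j,l} (m^i_{jl})^r by AM-GM, so the expectation factorises
   over the parts, and each factor is at most e^{delta n} with delta of order
   (ln d)^2 / d. Hence H is properly q-colored in this way with probability at
   least e^{-2 r delta n}. The largest number of vertices per part that a
   balanced q-coloring covers changes by at most 1 when the edges at one vertex
   of the first part change; by concentration, and because full coverage is not
   too unlikely, with overwhelming probability all but eta n vertices of each
   part are covered, with eta^2 of order delta. Finally, boxes of side at most
   2 eta n are so sparse that what remains, arranged into transversal tuples
   that are not edges, is degenerate enough to be colored greedily with a small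
   multiple of x further colors. *)

Require Import Defs.
From mathcomp Require Import all_boot all_order all_algebra.
From mathcomp Require Import fingroup perm.
From mathcomp Require Import all_classical all_reals all_analysis.
From mathcomp Require Import zify ring lra.

Set Implicit Arguments.
Unset Strict Implicit.
Unset Printing Implicit Defensive.

Import Order.TTheory GRing.Theory Num.Theory.
Local Open Scope ring_scope.

(** * Random subsets and concentration *)

(* The prefix rs refers to the random subset of F to which each element belongs
   independently with probability p. *)
Definition rs_wt (R : realType) (F : finType) (p : R) (S : {set F}) : R :=
  \prod_e (if e \in S then p else 1 - p).

Definition rs_E (R : realType) (F : finType) (p : R) (f : {set F} -> R) : R :=
  \sum_S rs_wt p S * f S.

Definition rs_Pr (R : realType) (F : finType) (p : R) (Q : pred {set F}) : R :=
  rs_E p (fun S => (Q S)%:R).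

Lemma sum_rs_wt (R : realType) (F : finType) (p : R) :
  \sum_(S : {set F}) rs_wt p S = 1.
Proof.
transitivity (\prod_(e : F) (p + (1 - p))); first by rewrite bigA_distr.
by rewrite big1// => e _; rewrite addrC subrK.
Qed.

Lemma rs_wt_ge0 (R : realType) (F : finType) (p : R) (S : {set F}) :
  0 <= p <= 1 -> 0 <= rs_wt p S.
Proof.
by case/andP=> p0 p1; apply: prodr_ge0 => e _; case: ifP; rewrite ?subr_ge0.
Qed.

Lemma rs_E_cst (R : realType) (F : finType) (p c : R) :
  rs_E p (fun _ : {set F} => c) = c.
Proof. by rewrite /rs_E -mulr_suml sum_rs_wt mul1r. Qed.

Lemma le_rs_E (R : realType) (F : finType) (p : R) (f g : {set F} -> R) :
  0 <= p <= 1 -> (forall S, f S <= g S) -> rs_E p f <= rs_E p g.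
Proof.
by move=> p01 fg; apply: ler_sum => S _; rewrite ler_wpM2l// rs_wt_ge0.
Qed.

Lemma rs_E_sum (R : realType) (F I : finType) (P : pred I) (p : R)
    (f : I -> {set F} -> R) :
  rs_E p (fun S => \sum_(i | P i) f i S) = \sum_(i | P i) rs_E p (f i).
Proof.
rewrite /rs_E exchange_big /=; apply: eq_bigr => S _.
by rewrite mulr_sumr.
Qed.

Lemma rs_EZ (R : realType) (F : finType) (p c : R) (f : {set F} -> R) :
  rs_E p (fun S => c * f S) = c * rs_E p f.
Proof. by rewrite /rs_E mulr_sumr; apply: eq_bigr => S _; rewrite mulrCA. Qed.

Lemma rs_ED (R : realType) (F : finType) (p : R) (f g : {set F} -> R) :
  rs_E p (fun S => f S + g S) = rs_E p f + rs_E p g.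
Proof. by rewrite /rs_E -big_split; apply: eq_bigr => S _; rewrite mulrDr. Qed.

Lemma eq_rs_E (R : realType) (F : finType) (p : R) (f g : {set F} -> R) :
  f =1 g -> rs_E p f = rs_E p g.
Proof. by move=> fg; apply: eq_bigr => S _; rewrite fg. Qed.

Lemma rs_Pr_ge0 (R : realType) (F : finType) (p : R) (Q : pred {set F}) :
  0 <= p <= 1 -> 0 <= rs_Pr p Q.
Proof.
by move=> p01; apply: sumr_ge0 => S _; rewrite mulr_ge0 ?ler0n ?rs_wt_ge0.
Qed.

Lemma le_rs_Pr (R : realType) (F : finType) (p : R) (Q Q' : pred {set F}) :
  0 <= p <= 1 -> (forall S, Q S -> Q' S) -> rs_Pr p Q <= rs_Pr p Q'.
Proof.
move=> p01 QQ'; apply: le_rs_E => // S; rewrite ler_nat.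
by case: (Q S) (QQ' S) => [->|].
Qed.

Lemma rs_Pr_bigor (R : realType) (F I : finType) (P : pred I) (p : R)
    (Q : I -> pred {set F}) : 0 <= p <= 1 ->
  rs_Pr p (fun S => [exists (i | P i), Q i S]) <= \sum_(i | P i) rs_Pr p (Q i).
Proof.
move=> p01; rewrite -rs_E_sum; apply: le_rs_E => // S.
case: existsP => [[i /andP[Pi QiS]]|_]; last by rewrite sumr_ge0.
by rewrite (bigD1 i)//= QiS lerDl sumr_ge0.
Qed.

Lemma rs_Pr_or (R : realType) (F : finType) (p : R) (Q Q' : pred {set F}) :
  0 <= p <= 1 -> rs_Pr p (fun S => Q S || Q' S) <= rs_Pr p Q + rs_Pr p Q'.
Proof.
move=> p01; rewrite -rs_ED; apply: le_rs_E => // S.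
by case: (Q S); case: (Q' S) => /=; lra.
Qed.

Lemma rs_PrC (R : realType) (F : finType) (p : R) (Q : pred {set F}) :
  rs_Pr p Q = 1 - rs_Pr p (fun S => ~~ Q S).
Proof.
apply/eqP; rewrite eq_sym subr_eq -rs_ED; apply/eqP.
rewrite -[LHS](rs_E_cst F p 1); apply: eq_rs_E => S.
by case: (Q S); rewrite ?addr0 ?add0r.
Qed.

(** The product of the sums [a e + b e] expands into a sum over all [S]; as [a] vanishes on [B] and
    [b] on [A], only the sets with the required pattern survive. *)
Lemma rs_Pr_pattern (R : realType) (F : finType) (p : R) (A B : {set F}) :
  [disjoint A & B] ->
  rs_Pr p (fun S => (A \subset S) && [disjoint B & S]) =
    p ^+ #|A| * (1 - p) ^+ #|B|.
Proof.
move=> AB.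
pose a e : R := if e \in B then 0 else p.
pose b e : R := if e \in A then 0 else 1 - p.
transitivity (\prod_e (a e + b e)).
  rewrite bigA_distr; apply: eq_bigr => S _.
  have [/andP[/fintype.subsetP sAS /pred0P dBS]|] := boolP (_ && _).
    rewrite mulr1; apply: eq_bigr => e _; rewrite /a /b.
    have := dBS e; rewrite /=; case: ifP => eS; rewrite ?andbT ?andbF => eB.
      by rewrite eB.
    by case: ifP => // /sAS; rewrite eS.
  rewrite negb_and mulr0 => /orP[/subsetPn[e eA eS]|/pred0Pn[e /andP[eB eS]]].
    by rewrite (bigD1 e)//= (negbTE eS) /b eA mul0r.
  by move: eB eS => /= eB eS; rewrite (bigD1 e)//= eS /a eB mul0r.
rewrite -!prodr_const [X in _ = X * _]big_mkcond [X in _ = _ * X]big_mkcond.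
rewrite -big_split; apply: eq_bigr => e _ /=; rewrite /a /b.
have /pred0P/(_ e)/= := AB.
by case: (e \in A); case: (e \in B) => //= _; rewrite ?add0r ?addr0 ?mulr1 ?mul1r // addrC subrK.
Qed.

Lemma rs_Pr_sub (R : realType) (F : finType) (p : R) (A : {set F}) :
  rs_Pr p (fun S => A \subset S) = p ^+ #|A|.
Proof.
have /rs_Pr_pattern -/(_ R p) : [disjoint A & (finset.set0 : {set F})].
  by apply/pred0P => e /=; rewrite inE andbF.
rewrite cards0 expr0 mulr1 => <-; apply: eq_rs_E => S.
by rewrite [X in _ && X](_ : _ = true) ?andbT //; apply/pred0P => e; rewrite /= inE.
Qed.

Lemma rs_Pr_disjoint (R : realType) (F : finType) (p : R) (B : {set F}) :
  rs_Pr p (fun S => [disjoint B & S]) = (1 - p) ^+ #|B|.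
Proof.
have /rs_Pr_pattern -/(_ R p) : [disjoint (finset.set0 : {set F}) & B].
  by apply/pred0P => e /=; rewrite inE.
rewrite cards0 expr0 mul1r => <-; apply: eq_rs_E => S.
by rewrite finset.sub0set.
Qed.

(* Expand E (X - t 1_{X != 0})^2 >= 0 with t chosen optimally. *)
Lemma rs_second_moment (R : realType) (F : finType) (p : R)
    (X : {set F} -> R) : 0 <= p <= 1 ->
  rs_E p X ^+ 2 <= rs_E p (fun S => X S ^+ 2) * rs_Pr p (fun S => X S != 0).
Proof.
move=> p01; set a := rs_E p (fun S => X S ^+ 2); set b := rs_Pr _ _; set m := rs_E p X.
have b0 : 0 <= b by apply: rs_Pr_ge0.
have key t : 0 <= a - 2 * t * m + t ^+ 2 * b.
  rewrite -mulrA -mulNr -!rs_EZ -!rs_ED; apply: sumr_ge0 => S _.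
  rewrite mulr_ge0 ?rs_wt_ge0//=; have [->|_] := eqVneq (X S) 0.
    by rewrite expr0n /=; lra.
  have -> : X S ^+ 2 + -2 * (t * X S) + t ^+ 2 * (~~ false)%:R = (X S - t) ^+ 2.
    by rewrite /=; ring.
  exact: sqr_ge0.
have [b_eq0|bN0] := eqVneq b 0.
  rewrite b_eq0 mulr0; have [->|mN0] := eqVneq m 0; first by rewrite expr0n.
  (* When [b = 0], the inequality [a - 2 t m >= 0] for every [t] forces [m = 0]: this [t] would make
     the left-hand side equal to -1. *)
  have := key ((a + 1) / (2 * m)); rewrite b_eq0 mulr0 addr0.
  have -> : a - 2 * ((a + 1) / (2 * m)) * m = -1 by field.
  by lra.
have b_gt0 : 0 < b by rewrite lt_def bN0.
have := key (m / b).
have -> : a - 2 * (m / b) * m + (m / b) ^+ 2 * b = a - m ^+ 2 / b by field.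
by rewrite subr_ge0 ler_pdivrMr.
Qed.

(** * Bounded differences over blocks of elements *)

Definition resample (F : finType) (K : eqType) (key : F -> K) (v : K)
    (S J : {set F}) : {set F} :=
  [set e | if key e == v then e \in J else e \in S].

(** The conditional expectation of [f] given all the blocks of [key] except the one at [v]. *)
Definition rs_avg (R : realType) (F : finType) (K : eqType) (p : R)
    (key : F -> K) (v : K) (f : {set F} -> R) (S : {set F}) : R :=
  rs_E p (fun J => f (resample key v S J)).

(** Bounded differences with constant 1; the one-sided inequality suffices since [S] and [S'] can be
    exchanged. *)
Definition lip (R : realType) (F : finType) (K : eqType) (key : F -> K)
    (f : {set F} -> R) :=
  forall v (S S' : {set F}), (forall e, key e != v -> (e \in S) = (e \in S')) ->
  f S <= f S' + 1.

(** Exchanging the blocks at [v] of two independent sets is an involution [h] that preserves the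
    product weight, so the resampled set has the law of [S]. *)
Lemma rs_E_avg (R : realType) (F : finType) (K : eqType) (p : R)
    (key : F -> K) (v : K) (f : {set F} -> R) :
  rs_E p (rs_avg p key v f) = rs_E p f.
Proof.
rewrite /rs_avg {1}/rs_E; under eq_bigr => S _ do rewrite mulr_sumr.
rewrite pair_big /=.
pose h (x : {set F} * {set F}) :=
  (resample key v x.1 x.2, resample key v x.2 x.1).
have hK : involutive h.
  move=> [S J]; congr pair; apply/setP => e; rewrite !inE /=.
    by case: eqP.
  by case: eqP.
rewrite (reindex_inj (inv_inj hK)) /=.
transitivity (\sum_(x : {set F} * {set F}) rs_wt p x.2 * (rs_wt p x.1 * f x.1)).
  apply: eq_bigr => -[S J] _ /=; have := hK (S, J); rewrite /h /= => -[-> _].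
  rewrite !mulrA; congr (_ * _); rewrite -!big_split /=; apply: eq_bigr => e _.
  rewrite !inE; case: eqP => // _; exact: mulrC.
rewrite -(pair_bigA _ (fun S J => rs_wt p J * (rs_wt p S * f S))) /=.
by apply: eq_bigr => S _; rewrite -mulr_suml sum_rs_wt mul1r.
Qed.

(** Both sets are resampled with the same [J], so they still agree outside the block [u]. *)
Lemma lip_avg (R : realType) (F : finType) (K : eqType) (p : R)
    (key : F -> K) (v : K) (f : {set F} -> R) :
  0 <= p <= 1 -> lip key f -> lip key (rs_avg p key v f).
Proof.
move=> p01 lf u S S' SS'.
rewrite -[X in _ + X](rs_E_cst F p) -rs_ED; apply: le_rs_E => // J.
by apply: (lf u) => e eu; rewrite !inE; case: ifP => // _; apply: SS'.
Qed.

(** From [expR (- u) >= 1 - u] follows [(1 - u) * expR u <= 1], while [(1 - u) * (1 + u + 2 * u ^+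
    2) = 1 + u ^+ 2 * (1 - 2 * u)] is at least 1. *)
Lemma expR_le_quad (R : realType) (u : R) :
  u <= 1 / 2 -> expR u <= 1 + u + 2 * u ^+ 2.
Proof.
move=> u2; have := expR_ge1Dx (- u); rewrite expRN => h.
have e0 := expR_gt0 u.
have : (1 - u) * expR u <= 1 by rewrite -ler_pdivlMr// mul1r.
have : 0 <= u ^+ 2 by apply: sqr_ge0.
by rewrite expr2 => ? ?; nra.
Qed.

(** Given the other blocks, [f] deviates from its conditional mean by at most 1. In the quadratic
    bound for the exponential the linear term averages out. *)
Lemma rs_avg_mgf (R : realType) (F : finType) (K : eqType) (p l : R)
    (key : F -> K) (v : K) (f : {set F} -> R) (S : {set F}) :
  0 <= p <= 1 -> `|l| <= 1 / 2 -> lip key f ->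
  rs_avg p key v (fun T => expR (l * f T)) S <=
    expR (2 * l ^+ 2) * expR (l * rs_avg p key v f S).
Proof.
move=> p01 l2 lf; rewrite {1}/rs_avg; set m := rs_avg p key v f S.
pose h J := f (resample key v S J).
have hm J : `|h J - m| <= 1.
  have hh J1 J2 : h J1 <= h J2 + 1.
    by apply: (lf v) => e /negbTE ev; rewrite !inE ev.
  have mE : m = rs_E p h by [].
  have m1 : m <= h J + 1.
    by rewrite -(rs_E_cst F p (h J + 1)) mE; apply: le_rs_E.
  have m2 : h J <= m + 1.
    rewrite -(rs_E_cst F p (h J)) mE -[X in _ + X](rs_E_cst F p) -rs_ED.
    exact: le_rs_E.
  by rewrite ler_norml; apply/andP; split; lra.
have bound J : expR (l * h J) <=
    expR (l * m) * (1 + l * (h J - m) + 2 * l ^+ 2).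
  have -> : l * h J = l * m + l * (h J - m) by ring.
  rewrite expRD ler_wpM2l ?expR_ge0//.
  apply: le_trans (expR_le_quad _) _.
    apply: le_trans (ler_norm _) _; rewrite normrM.
    by apply: le_trans (ler_pM _ _ l2 (hm J)) _ => //; rewrite mulr1.
  have : (h J - m) ^+ 2 <= 1 by rewrite -real_normK ?num_real// expr_le1.
  have : 0 <= l ^+ 2 by apply: sqr_ge0.
  rewrite exprMn; nra.
have -> : expR (2 * l ^+ 2) * expR (l * m) = expR (l * m) * expR (2 * l ^+ 2).
  exact: mulrC.
apply: (le_trans (le_rs_E p01 bound)).
rewrite rs_EZ ler_wpM2l ?expR_ge0//.
have -> : rs_E p (fun J => 1 + l * (h J - m) + 2 * l ^+ 2) = 1 + 2 * l ^+ 2.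
  rewrite !rs_ED !rs_E_cst rs_EZ rs_ED rs_E_cst.
  by rewrite [rs_E p h](_ : _ = m)// subrr mulr0 addr0.
exact: expR_ge1Dx.
Qed.

(* Averaging out the blocks one after the other costs a factor exp(2 l^2) each
   time, and once all the blocks are averaged out the function is constant. *)
Lemma rs_mgf (R : realType) (F K : finType) (p l : R)
    (key : F -> K) (f : {set F} -> R) :
  0 <= p <= 1 -> `|l| <= 1 / 2 -> lip key f ->
  rs_E p (fun S => expR (l * f S)) <=
    expR (2 * l ^+ 2 * #|K|%:R) * expR (l * rs_E p f).
Proof.
move=> p01 l2.
suff gen (s : seq K) (g : {set F} -> R) : lip key g ->
    (forall S S' : {set F}, (forall e, key e \in s -> (e \in S) = (e \in S')) ->
       g S = g S') ->
    rs_E p (fun S => expR (l * g S)) <=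
      expR (2 * l ^+ 2 * (size s)%:R) * expR (l * rs_E p g).
  move=> lf; have := gen (enum K) f lf; rewrite -cardE; apply=> S S' SS'.
  by congr f; apply/setP => e; apply: SS'; rewrite mem_enum.
elim: s g => [|v s IH] g lg gs.
  have gc S : g S = g finset.set0 by apply: gs.
  rewrite (eq_rs_E _ (g := fun=> expR (l * g finset.set0))); last by move=> S; rewrite gc.
  rewrite [in leRHS](eq_rs_E _ (g := fun=> g finset.set0)) //.
  by rewrite !rs_E_cst mulr0 expR0 mul1r.
rewrite -(rs_E_avg p key v).
apply: (le_trans (le_rs_E p01 (fun S => rs_avg_mgf v S p01 l2 lg))).
rewrite rs_EZ /= -(natr1 (size s)) mulrDr mulr1 addrC expRD -mulrA.
rewrite ler_wpM2l ?expR_ge0// -(rs_E_avg p key v g); apply: IH.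
  exact: lip_avg.
move=> S S' SS'; apply: eq_rs_E => J; apply: gs => e; rewrite !inE.
by case: eqP => //= _; apply: SS'.
Qed.

(** Markov's inequality for [exp (l f)] and for [exp (- l f)]: in the product of the two bounds the
    factors containing the mean of [f] cancel, so the mean need not be known. *)
Lemma rs_lower_tail (R : realType) (F K : finType) (p l eta M : R)
    (key : F -> K) (f : {set F} -> R) :
  0 <= p <= 1 -> 0 <= l <= 1 / 2 -> lip key f ->
  rs_Pr p (fun S => M <= f S) * rs_Pr p (fun S => f S <= M - eta) <=
    expR (4 * l ^+ 2 * #|K|%:R - l * eta).
Proof.
move=> p01 /andP[l0 l2] lf.
have up : rs_Pr p (fun S => M <= f S) <=
    expR (- (l * M)) * (expR (2 * l ^+ 2 * #|K|%:R) * expR (l * rs_E p f)).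
  have ln : `|l| <= 1 / 2 by rewrite ger0_norm.
  apply: le_trans _ (ler_wpM2l (expR_ge0 _) (rs_mgf p01 ln lf)).
  rewrite -rs_EZ; apply: le_rs_E => // S; rewrite -expRD.
  case: (lerP M (f S)) => [Mf|_]; last by rewrite expR_ge0.
  by rewrite -expR0 ler_expR addrC -mulrBr mulr_ge0// subr_ge0.
have lo : rs_Pr p (fun S => f S <= M - eta) <=
    expR (l * (M - eta)) * (expR (2 * l ^+ 2 * #|K|%:R) * expR (- l * rs_E p f)).
  have ln : `|- l| <= 1 / 2 by rewrite normrN ger0_norm.
  have := rs_mgf p01 ln lf; rewrite sqrrN => h.
  apply: le_trans _ (ler_wpM2l (expR_ge0 _) h).
  rewrite -rs_EZ; apply: le_rs_E => // S; rewrite -expRD.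
  case: (lerP (f S)) => [Mf|_]; last by rewrite expR_ge0.
  by rewrite -expR0 ler_expR mulNr -mulrBr mulr_ge0// subr_ge0.
apply: le_trans (ler_pM _ _ up lo) _; rewrite ?rs_Pr_ge0//.
rewrite -!expRD ler_expR; nra.
Qed.

(** * Second moment of the number of colorings *)

Definition cls (T C : finType) (tau : {ffun T -> C}) (j : C) : {set T} :=
  [set v | tau v == j].

Definition cls_prof (T C : finType) (tau : {ffun T -> C}) : {ffun C -> nat} :=
  [ffun j => #|cls tau j|].

Definition prof_class (T C : finType) (m : {ffun C -> nat}) :
  {set {ffun T -> C}} := [set tau | cls_prof tau == m].

Lemma sum_cls (T C : finType) (tau : {ffun T -> C}) :
  (\sum_j #|cls tau j| = #|T|)%N.
Proof.
rewrite -sum1_card (partition_big tau predT)//=; apply: eq_bigr => j _.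
by rewrite -sum1_card; apply: eq_bigl => v; rewrite inE.
Qed.

Definition shift_prof (C : finType) (i j : C) (m : {ffun C -> nat}) :
  {ffun C -> nat} :=
  [ffun l => if l == i then (m i).-1 else if l == j then (m j).+1 else m l].

(* Double count the pairs (coloring, vertex of color i): recoloring the vertex
   with j maps them injectively to the pairs (coloring, vertex of color j). *)
Lemma leq_card_shift_prof (T C : finType) (i j : C) (m : {ffun C -> nat}) :
  (m j < m i)%N ->
  (#|prof_class T m| <= #|prof_class T (shift_prof i j m)|)%N.
Proof.
move=> mji; have ij : i != j by apply: contraTneq mji => ->; rewrite ltnn.
set m' := shift_prof i j m.
pose A (l : C) (mu : {ffun C -> nat}) : {set {ffun T -> C} * T} :=
  [set x | (x.1 \in prof_class T mu) && (x.1 x.2 == l)].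
have cA l mu : #|A l mu| = (#|prof_class T mu| * mu l)%N.
  rewrite -sum1_card (eq_bigl (fun x : {ffun T -> C} * T =>
    (x.1 \in prof_class T mu) && (x.1 x.2 == l))); last by move=> x; rewrite inE.
  rewrite -(pair_big_dep (fun t => t \in prof_class T mu) (fun t v => t v == l)
    (fun _ _ => 1%N)) /=.
  rewrite -sum_nat_const; apply: eq_bigr => t; rewrite inE => /eqP <-.
  by rewrite ffunE -sum1_card; apply: eq_bigl => v; rewrite inE.
pose g (x : {ffun T -> C} * T) :=
  ([ffun v => if v == x.2 then j else x.1 v], x.2).
have gi : {in A i m &, injective g}.
  move=> [t v] [t' v']; rewrite !inE /= => /andP[_ /eqP tv] /andP[_ /eqP tv'].
  rewrite /g /= => -[/ffunP tt' vv']; rewrite -vv' in tv' tt' *.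
  congr pair; apply/ffunP => u; have := tt' u; rewrite !ffunE.
  by case: eqP => // -> _; rewrite tv tv'.
have gA : [set g x | x in A i m] \subset A j m'.
  apply/fintype.subsetP => _ /imsetP[[t v] + ->]; rewrite !inE /= ffunE eqxx.
  move=> /andP[/eqP/ffunP tm /eqP tv]; rewrite eqxx andbT.
  apply/eqP/ffunP => l; rewrite !ffunE.
  have cl k : cls [ffun v0 => if v0 == v then j else t v0] k =
      [set u | if u == v then k == j else t u == k].
    by apply/setP => u; rewrite !inE ffunE; case: (u == v) => //=; exact: eq_sym.
  rewrite cl; have [->|li] := eqVneq l i.
    rewrite -tm ffunE (cardsD1 v (cls t i)) inE tv eqxx /=.
    apply: eq_card => u; rewrite !inE (negbTE ij).
    by case: eqP.
  have [->|lj] := eqVneq l j.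
    rewrite -tm ffunE; transitivity #|v |: cls t j|.
      by apply: eq_card => u; rewrite !inE; case: eqP.
    by rewrite cardsU1 inE tv ij.
  rewrite -tm ffunE; apply: eq_card => u; rewrite !inE.
  by case: eqP => // ->; rewrite tv eq_sym (negbTE li).
have := subset_leq_card gA; rewrite (card_in_imset gi) !cA.
rewrite /m' ffunE eq_sym (negbTE ij) eqxx => h.
have : (#|prof_class T m| * m i <= #|prof_class T m'| * m i)%N.
  by apply: leq_trans h _; rewrite leq_mul2l mji orbT.
by rewrite leq_pmul2r//; apply: leq_ltn_trans mji.
Qed.

(** Among the profiles shared by the most colorings take one with the least sum of squares. If two
    class sizes differed by 2 or more, a shift would keep the number of colorings maximal and lower
    the sum of squares. *)
Lemma equitable_profile (T C : finType) : (0 < #|C|)%N ->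
  exists m : {ffun C -> nat},
    (#|C| ^ #|T| <= #|prof_class T m| * #|T|.+1 ^ #|C|)%N /\
    (forall i j, m i <= (m j).+1)%N.
Proof.
case/card_gt0P => c0 _; pose t0 : {ffun T -> C} := [ffun=> c0].
pose Nt (t : {ffun T -> C}) := #|prof_class T (cls_prof t)|.
pose sq (m : {ffun C -> nat}) := (\sum_j m j ^ 2)%N.
have [t1 _ t1max] := @arg_maxnP _ t0 predT Nt isT.
have [t /eqP tN tmin] :=
  @arg_minnP _ t1 (fun t => Nt t == Nt t1) (fun t => sq (cls_prof t)) (eqxx _).
exists (cls_prof t); split; last first.
  move=> i j; rewrite leqNgt; apply/negP => ij; set m := cls_prof t in ij.
  have := @leq_card_shift_prof T C i j m (ltn_trans (ltnSn _) ij).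
  set m' := shift_prof i j m => N'.
  have : (0 < #|prof_class T m'|)%N.
    apply: leq_trans N'; apply/card_gt0P; exists t; by rewrite inE.
  case/card_gt0P => t'; rewrite inE => /eqP t'm'.
  have : Nt t' == Nt t1.
    by rewrite eqn_leq (t1max t' isT : (_ <= _)%N) -tN /Nt t'm'.
  move/tmin; rewrite t'm' -/m leqNgt => /negP; apply.
  have neq : i != j by apply: contraTneq ij => ->; lia.
  rewrite /sq (bigD1 i)//= (bigD1 j) 1?eq_sym//= [X in (_ < X)%N](bigD1 i)//=.
  rewrite [X in (_ < _ + X)%N](bigD1 j) 1?eq_sym//=.
  have -> : m' i = (m i).-1 by rewrite ffunE eqxx.
  have -> : m' j = (m j).+1 by rewrite ffunE eq_sym (negbTE neq) eqxx.
  rewrite (eq_bigr (fun l => m l ^ 2)%N); last first.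
    by move=> l /andP[/negbTE li /negbTE lj]; rewrite ffunE li lj.
  set X := (\sum_(l | _) _)%N.
  by case: (m i) ij => // k kj; rewrite !addnA ltn_add2r /= -!mulnn; nia.
(* Pigeonhole: the colorings fall into at most [#|T|.+1 ^ #|C|] profiles, none of which is shared by
   more colorings than the chosen one. *)
rewrite -card_ffun -(sum1_card {ffun T -> C}).
pose pr (t' : {ffun T -> C}) : {ffun C -> 'I_#|T|.+1} :=
  [ffun j => inord (cls_prof t' j)].
rewrite (partition_big pr predT)//=.
have prE t' : cls_prof t' = [ffun j => val (pr t' j)].
  apply/ffunP => j; rewrite !ffunE /= inordK// ltnS.
  exact: max_card.
have -> : (#|prof_class T (cls_prof t)| * #|T|.+1 ^ #|C| =
    \sum_(mu : {ffun C -> 'I_#|T|.+1}) #|prof_class T (cls_prof t)|)%N.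
  by rewrite sum_nat_const card_ffun !card_ord mulnC.
apply: leq_sum => mu _; have [[t' /eqP prt']|no] := pselect (exists t', pr t' == mu).
  rewrite -/(Nt t) tN; apply: leq_trans (t1max t' isT).
  rewrite sum1_card; apply: subset_leq_card; apply/fintype.subsetP => u.
  move=> hu; have pu : pr u = mu by apply/eqP; exact: hu.
  by rewrite inE !prE pu prt'.
by rewrite big_pred0// => u; apply/negP => pu; apply: no; exists u.
Qed.

Definition ovl (T C : finType) (sigma tau : {ffun T -> C}) (x : C * C) :
  {set T} := [set v | (sigma v, tau v) == x].

Lemma sum_ovl (T C : finType) (sigma tau : {ffun T -> C}) (j : C) :
  (\sum_l #|ovl sigma tau (j, l)| = #|cls sigma j|)%N.
Proof.
rewrite -sum1_card (partition_big tau predT)//=; apply: eq_bigr => l _.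
by rewrite -sum1_card; apply: eq_bigl => v; rewrite !inE xpair_eqE.
Qed.

(* The exponential is dominated by e^(delta n) q^n times the product over v of
   the proportions m_(sigma v, tau v) / s_(sigma v). For a fixed overlap matrix
   m these products sum to at most 1 over tau, and there are at most
   (n + 1)^(q^2) matrices. *)
Lemma overlap_mgf (R : realType) (T C : finType) (sigma : {ffun T -> C})
    (r : nat) (a delta : R) :
  (forall j m, (m <= #|cls sigma j|)%N -> a * m%:R ^+ r <= delta * m%:R +
     m%:R * ln (#|C|%:R * m%:R / #|cls sigma j|%:R) - m%:R +
     #|cls sigma j|%:R / #|C|%:R) ->
  \sum_tau expR (a * \sum_x #|ovl sigma tau x|%:R ^+ r) <=
    #|T|.+1%:R ^+ (#|C| ^ 2) * #|C|%:R ^+ #|T| * expR (delta * #|T|%:R).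
Proof.
move=> hpt; set q := #|C|; set n := #|T|.
pose w (mu : C * C -> nat) (tau : {ffun T -> C}) : R :=
  \prod_v ((mu (sigma v, tau v))%:R / #|cls sigma (sigma v)|%:R).
have clsP v : (0 < #|cls sigma (sigma v)|)%N.
  by apply/card_gt0P; exists v; rewrite inE.
have C0 (v : T) : (0 < q)%N by apply/card_gt0P; exists (sigma v).
(* The hypothesis is summed over all pairs of colors, [m] being the overlap of the pair; the terms
   [m] and [s / q] both total [n] and cancel. *)
have pt tau : expR (a * \sum_x #|ovl sigma tau x|%:R ^+ r) <=
    expR (delta * n%:R) * q%:R ^+ n * w (fun x => #|ovl sigma tau x|) tau.
  rewrite -mulrA.
  have -> : q%:R ^+ n * w (fun x => #|ovl sigma tau x|) tau =
      expR (\sum_v ln (q%:R * #|ovl sigma tau (sigma v, tau v)|%:R /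
                       #|cls sigma (sigma v)|%:R)).
    rewrite expR_sum /w /n -prodr_const -big_split /=.
    apply: eq_bigr => v _; rewrite lnK ?mulrA// posrE divr_gt0 ?mulr_gt0 ?ltr0n//.
      exact: C0.
    by apply/card_gt0P; exists v; rewrite inE.
  rewrite -expRD ler_expR.
  have -> : \sum_v ln (q%:R * #|ovl sigma tau (sigma v, tau v)|%:R /
                       #|cls sigma (sigma v)|%:R) =
      \sum_x #|ovl sigma tau x|%:R *
        ln (q%:R * #|ovl sigma tau x|%:R / #|cls sigma x.1|%:R) :> R.
    rewrite (partition_big (fun v => (sigma v, tau v)) predT)//=.
    apply: eq_bigr => x _.
    rewrite (eq_bigr (fun=> ln (q%:R * #|ovl sigma tau x|%:R /
       #|cls sigma x.1|%:R))); last by move=> v /eqP <-.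
    move: (ln _) => c; rewrite mulr_natl -sumr_const; apply: eq_bigl => v; by rewrite inE.
  have sum1 : \sum_x #|ovl sigma tau x|%:R = n%:R :> R.
    rewrite -(pair_bigA _ (fun j l => #|ovl sigma tau (j, l)|%:R)) /=.
    under eq_bigr => j _ do rewrite -natr_sum sum_ovl.
    by rewrite -natr_sum sum_cls.
  have sum2 : \sum_(x : C * C) #|cls sigma x.1|%:R / q%:R = n%:R :> R.
    rewrite -(pair_bigA _ (fun j (l : C) => #|cls sigma j|%:R / q%:R)) /=.
    under eq_bigr => j _ do rewrite sumr_const.
    have [q0|q0] := posnP q.
      rewrite big1 => [|j _]; first by rewrite -sum1 big1// => -[j l];
        move: (max_card (pred1 j)); rewrite -/q q0 card1.
      by move: (max_card (pred1 j)); rewrite -/q q0 card1.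
    transitivity (\sum_j #|cls sigma j|%:R : R).
      by apply: eq_bigr => j _; rewrite -[LHS]mulr_natr divfK// pnatr_eq0 -lt0n.
    by rewrite -natr_sum sum_cls.
  rewrite mulr_sumr.
  have -> : delta * n%:R = delta * n%:R - n%:R + n%:R by ring.
  rewrite -{1 2}sum1 -sum2 mulr_sumr -sumrB -!big_split /=.
  apply: ler_sum => -[j l] _ /=.
  have ml : (#|ovl sigma tau (j, l)| <= #|cls sigma j|)%N.
    by rewrite -(sum_ovl sigma tau j) (bigD1 l)//= leq_addr.
  apply: le_trans (hpt j _ ml) _.
  by rewrite [X in X + _ <= _]addrAC [leLHS]addrAC.
apply: le_trans (ler_sum _ (fun tau _ => pt tau)) _.
rewrite -mulr_sumr [leRHS]mulrAC -[leRHS]mulrA [leRHS]mulrC.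
rewrite ler_wpM2l ?mulr_ge0 ?exprn_ge0 ?expR_ge0//.
pose pr (tau : {ffun T -> C}) : {ffun C * C -> 'I_n.+1} :=
  [ffun x => inord #|ovl sigma tau x|].
have prE tau x : val (pr tau x) = #|ovl sigma tau x|.
  by rewrite ffunE /= inordK// ltnS max_card.
rewrite (partition_big pr predT)//=.
have -> : n.+1%:R ^+ (q ^ 2) = \sum_(mu : {ffun C * C -> 'I_n.+1}) 1 :> R.
  by rewrite sumr_const card_ffun card_prod card_ord -/q mulnn natrX.
apply: ler_sum => mu _.
have [[t /eqP prt]|no] := pselect (exists t, pr t == mu); last first.
  by rewrite big_pred0// => u; apply/negP => pu; apply: no; exists u.
(* Without the restriction to the overlap matrix [mu] the sum over [tau] factorises over [v]; each
   factor is a row sum of [mu], which [t] realises, over the class size, hence 1. *)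
apply: le_trans (_ : \sum_tau w (fun x => val (mu x)) tau <= _).
  rewrite big_mkcond; apply: ler_sum => tau _; case: eqP => [<-|_].
    by rewrite /w; under eq_bigr do rewrite -prE.
  by apply: prodr_ge0 => v _; rewrite divr_ge0.
rewrite /w -(bigA_distr_bigA
  (fun v l => (val (mu (sigma v, l)))%:R / #|cls sigma (sigma v)|%:R : R)).
rewrite big1// => v _; rewrite -mulr_suml -natr_sum.
rewrite (eq_bigr (fun l => #|ovl sigma t (sigma v, l)|)).
  by rewrite sum_ovl divff// pnatr_eq0 -lt0n clsP.
by move=> l _; rewrite -prt prE.
Qed.

(** * Monochromatic potential edges and the second moment *)

Definition box (I T : finType) (W : I -> {set T}) : {set {ffun I -> T}} :=
  [set f : {ffun I -> T} | [forall i, f i \in W i]].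

Lemma card_box (I T : finType) (W : I -> {set T}) :
  #|box W| = (\prod_i #|W i|)%N.
Proof.
under eq_bigr => i _ do rewrite -sum1_card big_mkcond.
rewrite bigA_distr_bigA -[LHS]sum1_card big_mkcond; apply: eq_bigr => f _.
rewrite inE; case: forallP => [fW|]; first by rewrite big1// => i _; rewrite fW.
move/forallP; rewrite negb_forall => /existsP[i fi].
by rewrite (bigD1 i)//= (negbTE fi).
Qed.

(** The boxes are pairwise disjoint, as their sides in the coordinate [i0] are. *)
Lemma card_cup_box (L I T : finType) (i0 : I) (B : L -> I -> {set T}) :
  (forall l l' v, v \in B l i0 -> v \in B l' i0 -> l = l') ->
  #|[set f : {ffun I -> T} | [exists l, [forall i, f i \in B l i]]]| =
    (\sum_l \prod_i #|B l i|)%N.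
Proof.
move=> dB; under eq_bigr => l _ do rewrite -card_box -sum1_card big_mkcond.
rewrite exchange_big -[LHS]sum1_card big_mkcond /=; apply: eq_bigr => f _.
rewrite inE; case: existsP => [[l fl]|no].
  rewrite (bigD1 l)//= inE fl big1 => [|l' l'l]; first by rewrite addn0.
  rewrite inE; case: forallP => // fl'; case/eqP: l'l.
  by apply: dB (fl' i0) _; exact: (forallP fl i0).
by rewrite big1// => l _; rewrite inE; case: ifP => // fl; case: no; exists l.
Qed.

(** With part [i] colored by [s i], an edge set is properly colored exactly when it avoids this
    set. *)
Definition mono (I T C : finType) (s : {ffun I -> {ffun T -> C}}) :
  {set {ffun I -> T}} := [set f : {ffun I -> T} | [exists l, [forall i, f i \in cls (s i) l]]].

Lemma card_mono (I T C : finType) (i0 : I) (s : {ffun I -> {ffun T -> C}}) :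
  #|mono s| = (\sum_l \prod_i #|cls (s i) l|)%N.
Proof.
by apply: (card_cup_box (i0 := i0)) => l l' v; rewrite !inE => /eqP-> /eqP.
Qed.

Lemma card_monoI (I T C : finType) (i0 : I) (s t : {ffun I -> {ffun T -> C}}) :
  #|mono s :&: mono t| = (\sum_x \prod_i #|ovl (s i) (t i) x|)%N.
Proof.
rewrite -(card_cup_box (i0 := i0)); last first.
  by move=> x x' v; rewrite !inE => /eqP-> /eqP.
apply: eq_card => f; rewrite !inE; apply/andP/existsP.
  case=> /existsP[l /forallP fl] /existsP[l' /forallP fl']; exists (l, l').
  apply/forallP => i; have := fl i; have := fl' i.
  by rewrite !inE xpair_eqE => -> ->.
case=> -[l l'] /forallP fl; split; apply/existsP; [exists l|exists l'];
  by apply/forallP => i; have := fl i; rewrite !inE xpair_eqE => /andP[].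
Qed.

(** AM-GM for the numbers [x i ^+ #|I|], followed by taking roots. *)
Lemma prod_le_mean_pow (R : realType) (I : finType) (x : I -> R) :
  (0 < #|I|)%N -> (forall i, 0 <= x i) ->
  \prod_i x i <= (\sum_i x i ^+ #|I|) / #|I|%:R.
Proof.
move=> I0 x0.
have [+ _] := @leif_AGM _ I predT (fun i => x i ^+ #|I|)
  (fun i _ => exprn_ge0 _ (x0 i)).
rewrite prodrXl cardT /= -cardT ler_pXn2r ?nnegrE ?prodr_ge0 ?divr_ge0//.
by apply: sumr_ge0 => i _; rewrite exprn_ge0.
Qed.

Definition has_mono_coloring (I T C : finType) (m : {ffun C -> nat})
    (S : {set {ffun I -> T}}) : bool :=
  [exists s : {ffun I -> {ffun T -> C}},
    [forall i, s i \in prof_class T m] && [disjoint mono s & S]].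

(** The second moment method for the number [X] of proper colorings with profile [m] in every part;
    [overlap_mgf] bounds the contribution of each part to the second moment. *)
Lemma coloring_second_moment (R : realType) (I T C : finType)
    (m : {ffun C -> nat}) (p delta : R) : (0 < #|I|)%N -> 0 <= p < 1 ->
  (forall j k, (k <= m j)%N ->
     - ln (1 - p) / #|I|%:R * k%:R ^+ #|I| <= delta * k%:R +
     k%:R * ln (#|C|%:R * k%:R / (m j)%:R) - k%:R + (m j)%:R / #|C|%:R) ->
  #|prof_class T m|%:R ^+ #|I| <=
    (#|T|.+1%:R ^+ (#|C| ^ 2) * #|C|%:R ^+ #|T| * expR (delta * #|T|%:R)) ^+ #|I|
    * rs_Pr p (has_mono_coloring (I := I) (T := T) m).
Proof.
move=> I0 /andP[p0 p1] hpt.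
have p01 : 0 <= p <= 1 by rewrite p0 ltW.
have [i0 _] := card_gt0P I0.
set N := #|prof_class T m|; set r := #|I|; set B := _ * expR _.
pose Q := [set s : {ffun I -> {ffun T -> C}} |
            [forall i, s i \in prof_class T m]].
have cQ : #|Q| = (N ^ r)%N.
  by rewrite (card_box (fun=> prof_class T m)) prod_nat_const.
pose X (S : {set {ffun I -> T}}) : R := \sum_(s in Q) [disjoint mono s & S]%:R.
pose kappa := (\sum_l m l ^ r)%N.
have monoQ s : s \in Q -> #|mono s| = kappa.
  rewrite inE => /forallP sm; rewrite (card_mono i0); apply: eq_bigr => l _.
  rewrite (eq_bigr (fun=> m l)) ?prod_nat_const// => i _.
  by have := sm i; rewrite inE => /eqP <-; rewrite ffunE.
have EX : rs_E p X = (N ^ r)%:R * (1 - p) ^+ kappa.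
  rewrite rs_E_sum (eq_bigr (fun=> (1 - p) ^+ kappa)) => [|s sQ].
    by rewrite sumr_const cQ mulr_natl.
  by rewrite -(monoQ s sQ) -rs_Pr_disjoint.
have q0 : 0 < 1 - p by rewrite subr_gt0.
pose b := - ln (1 - p).
have b0 : 0 <= b by rewrite oppr_ge0 ln_le0// gerBl.
have EX2 : rs_E p (fun S => X S ^+ 2) <=
    (N ^ r)%:R * (1 - p) ^+ kappa ^+ 2 * B ^+ r.
  have -> : rs_E p (fun S => X S ^+ 2) = \sum_(s in Q) \sum_(t in Q)
      (1 - p) ^+ #|mono s :|: mono t|.
    transitivity (rs_E p (fun S => \sum_(s in Q) \sum_(t in Q)
        [disjoint mono s :|: mono t & S]%:R)).
      apply: eq_rs_E => S; rewrite expr2 /X mulr_suml; apply: eq_bigr => s _.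
      rewrite mulr_sumr; apply: eq_bigr => t _; rewrite -natrM mulnb.
      congr ((_ : bool)%:R); rewrite -!setI_eq0 finset.setIUl.
      by rewrite finset.setU_eq0.
    rewrite rs_E_sum; apply: eq_bigr => s _.
    by rewrite rs_E_sum; apply: eq_bigr => t _; rewrite -rs_Pr_disjoint.
  rewrite -cQ -mulrA [leRHS]mulr_natl -sumr_const; apply: ler_sum => s sQ.
  (* Two colorings are both proper with probability [1 - p] to the size of the union of their
     monochromatic sets, which is [2 kappa] minus the size of the intersection. *)
  apply: le_trans (_ : \sum_(t in Q) (1 - p) ^+ kappa ^+ 2 *
     expR (b * #|mono s :&: mono t|%:R) <= _).
    apply: ler_sum => t tQ.
    have -> : expR (b * #|mono s :&: mono t|%:R) =
        ((1 - p) ^+ #|mono s :&: mono t|)^-1.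
      by rewrite /b mulNr expRN expRM_natr lnK.
    rewrite ler_pdivlMr ?exprn_gt0// -exprD cardsUI !monoQ// -exprM.
    by rewrite muln2 addnn.
  rewrite -mulr_sumr ler_wpM2l ?exprn_ge0 ?(ltW q0)//.
  (* AM-GM turns the product over the parts in the intersection size into a mean of powers; enlarged
     to all [t], the sum then factorises over the parts. *)
  apply: le_trans (_ : \sum_(t : {ffun I -> {ffun T -> C}})
    \prod_i expR (b / r%:R * \sum_x #|ovl (s i) (t i) x|%:R ^+ r) <= _).
    rewrite big_mkcond; apply: ler_sum => t _.
    case: ifP => _; last by apply: prodr_ge0 => i _; rewrite expR_ge0.
    rewrite -expR_sum ler_expR -mulr_sumr mulrAC -mulrA ler_wpM2l//.
    rewrite (card_monoI i0) natr_sum exchange_big /= mulr_suml.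
    apply: ler_sum => x _; rewrite natr_prod.
    exact: prod_le_mean_pow.
  rewrite -(bigA_distr_bigA (fun i t => expR (b / r%:R *
    \sum_x #|ovl (s i) t x|%:R ^+ r))).
  rewrite /r -prodr_const; apply: ler_prod => i _; apply/andP; split.
    by apply: sumr_ge0 => t _; rewrite expR_ge0.
  apply: overlap_mgf => j k.
  have := forallP (_ : [forall i, s i \in prof_class T m]) i.
  move: sQ; rewrite inE => sQ /(_ sQ); rewrite inE => /eqP/ffunP/(_ j).
  by rewrite ffunE => ->; exact: hpt.
have PX : rs_Pr p (fun S => X S != 0) <=
    rs_Pr p (has_mono_coloring (I := I) (T := T) m).
  apply: le_rs_Pr => // S; apply: contraNT => /existsPn no.
  rewrite /X big1// => s; rewrite inE => sQ.
  by have := no s; rewrite sQ /= => /negbTE ->.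
set P := rs_Pr p (has_mono_coloring _) in PX *.
have [N0|N0] := posnP N.
  rewrite N0 expr0n eqn0Ngt I0 /= mulr_ge0 ?rs_Pr_ge0 ?exprn_ge0//.
  by rewrite !mulr_ge0 ?exprn_ge0 ?expR_ge0.
have := rs_second_moment X p01; rewrite EX => h.
have Nr0 : 0 < (N ^ r)%:R :> R by rewrite ltr0n expn_gt0 N0.
have k0 : 0 < (1 - p) ^+ kappa ^+ 2 by rewrite !exprn_gt0.
have {}h : ((N ^ r)%:R * (1 - p) ^+ kappa) ^+ 2 <=
    (N ^ r)%:R * (1 - p) ^+ kappa ^+ 2 * B ^+ r * P.
  apply: le_trans h _; apply: ler_pM => //; first last.
    exact: rs_Pr_ge0.
  by apply: sumr_ge0 => S _; rewrite mulr_ge0 ?rs_wt_ge0 ?sqr_ge0.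
rewrite -natrX -(ler_pM2l Nr0) -(ler_pM2r k0); move: h.
move: ((1 - p) ^+ kappa) (N ^ r)%:R (B ^+ r) => x y z; rewrite exprMn !expr2.
by have -> : y * (z * P) * (x * x) = y * (x * x) * z * P by ring.
Qed.

(** * Balanced colorings as colorings of transversal tuples *)

Definition tuple_edge (I T : finType) (pi : {ffun I -> {perm T}})
    (g : {ffun I -> T}) : {ffun I -> T} := [ffun i => pi i (g i)].

Lemma tuple_edge_inj (I T : finType) (pi : {ffun I -> {perm T}}) :
  injective (tuple_edge pi).
Proof.
move=> f g /ffunP fg; apply/ffunP => i; have := fg i; rewrite !ffunE.
exact: perm_inj.
Qed.

(* A balanced partial coloring is encoded by arranging the vertices into
   transversal tuples (the j-th one consists of the vertices pi i j) and by
   coloring the tuples, None meaning uncolored. *)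
Definition good_partial (I T C : finType) (S : {set {ffun I -> T}})
    (x : {ffun I -> {perm T}} * {ffun T -> option C}) : bool :=
  [forall g : {ffun I -> T}, forall l,
    [forall i, x.2 (g i) == Some l] ==> (tuple_edge x.1 g \notin S)].

Definition colored (T C : finType) (c : {ffun T -> option C}) : {set T} :=
  [set j | c j != None].

Definition max_colored (I T C : finType) (S : {set {ffun I -> T}}) : nat :=
  \max_(x : {ffun I -> {perm T}} * {ffun T -> option C} | good_partial S x)
    #|colored x.2|.

Lemma max_coloredP (I T C : finType) (i0 : I) (S : {set {ffun I -> T}}) :
  exists2 x : {ffun I -> {perm T}} * {ffun T -> option C},
    good_partial S x & max_colored C S = #|colored x.2|.
Proof.
pose x0 : {ffun I -> {perm T}} * {ffun T -> option C} :=
  ([ffun=> 1%g], [ffun=> None]).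
have gx0 : good_partial S x0.
  apply/forallP => g; apply/forallP => l; apply/implyP => /forallP/(_ i0).
  by rewrite ffunE.
have [|x gx mx] := @eq_bigmax_cond _ (good_partial S)
  (fun x : {ffun I -> {perm T}} * {ffun T -> option C} => #|colored x.2|).
  by apply/card_gt0P; exists x0.
by exists x.
Qed.

(** Uncolor the one tuple that contains the vertex [v] of part [i0]: the edges through [v] no longer
    matter, and at most one colored tuple is lost. *)
Lemma lip_max_colored (R : realType) (I T C : finType) (i0 : I) :
  lip (fun g : {ffun I -> T} => g i0)
    (fun S => (max_colored C S)%:R : R).
Proof.
move=> v S S' SS'; have [[pi c] gx ->] := max_coloredP C i0 S.
pose c' : {ffun T -> option C} :=
  [ffun j => if pi i0 j == v then None else c j].
have gx' : good_partial S' (pi, c').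
  apply/forallP => g; apply/forallP => l; apply/implyP => /forallP h.
  have := forallP (forallP gx g) l => /implyP /=.
  have vi i : pi i0 (g i) != v.
    by have := h i; rewrite /= ffunE; case: ifP => // /negbT.
  rewrite SS'; last by rewrite ffunE vi.
  by apply; apply/forallP => i; have := h i; rewrite ffunE /= (negbTE (vi i)).
apply: (le_trans (y := (#|colored c'| + 1)%:R)); last first.
  by rewrite natrD lerD2r ler_nat; apply: (bigop.bigmax_sup (pi, c')).
rewrite ler_nat /= -(cards1 ((pi i0)^-1%g v)).
apply: leq_trans (leq_card_setU _ _).
apply: subset_leq_card; apply/fintype.subsetP => j; rewrite !inE ffunE.
by have [<- _|_ ->//] := eqVneq (pi i0 j) v; rewrite permK eqxx orbT.
Qed.

(** Within each color, the k-th element of the class of [b] is sent to the k-th element of the class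
    of [a]. *)
Lemma cls_prof_perm (T C : finType) (a b : {ffun T -> C}) :
  cls_prof a = cls_prof b -> exists s : {perm T}, forall j, a (s j) = b j.
Proof.
move=> /ffunP ab.
have sab l : size (enum (cls a l)) = size (enum (cls b l)).
  by have := ab l; rewrite !ffunE !cardE.
pose s j := nth j (enum (cls a (b j))) (index j (enum (cls b (b j)))).
have jb j : j \in enum (cls b (b j)) by rewrite mem_enum inE.
have ib j : (index j (enum (cls b (b j))) < size (enum (cls a (b j))))%N.
  by rewrite sab index_mem.
have as_ j : a (s j) = b j.
  by have := mem_nth j (ib j); rewrite mem_enum inE => /eqP.
have s_inj : injective s.
  move=> j j' ss; have bb : b j = b j' by rewrite -!as_ ss.
  have ib' := ib j'; have jb' := jb j'; rewrite -bb in ib' jb'.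
  have /eqP := ss; rewrite /s -bb (set_nth_default j j' ib').
  rewrite nth_uniq ?enum_uniq// => /eqP idx.
  by rewrite -(nth_index j (jb j)) idx nth_index.
by exists (perm s_inj) => j; rewrite permE.
Qed.

(** All parts have the same class sizes, so each can be permuted to be colored like part [i0]; then
    the vertices of every tuple share a color. *)
Lemma max_colored_mono (I T C : finType) (i0 : I) (m : {ffun C -> nat})
    (S : {set {ffun I -> T}}) :
  has_mono_coloring m S -> (#|T| <= max_colored C S)%N.
Proof.
case/existsP => s /andP[/forallP sm dS].
have ex i : exists p : {perm T}, [forall j, s i (p j) == s i0 j].
  have [p hp] : exists p : {perm T}, forall j, s i (p j) = s i0 j.
    apply: cls_prof_perm; have := sm i; have := sm i0.
    by rewrite !inE => /eqP-> /eqP.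
  by exists p; apply/forallP => j; rewrite hp.
pose pi : {ffun I -> {perm T}} := [ffun i => xchoose (ex i)].
have piP i j : s i (pi i j) = s i0 j.
  by rewrite ffunE; exact/eqP/(forallP (xchooseP (ex i))).
pose c : {ffun T -> option C} := [ffun j => Some (s i0 j)].
apply: leq_trans (_ : #|colored c| <= _)%N.
  by rewrite -cardsT subset_leq_card//; apply/fintype.subsetP => j; rewrite !inE ffunE.
apply: (bigop.bigmax_sup (pi, c)) => //.
apply/forallP => g; apply/forallP => l; apply/implyP => /forallP /= h.
have /pred0P/(_ (tuple_edge pi g))/= := dS.
suff -> : tuple_edge pi g \in mono s by move=> /= ->.
rewrite inE; apply/existsP; exists l; apply/forallP => i.
by rewrite inE [X in s i X]ffunE piP; have := h i; rewrite ffunE.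
Qed.

(** * Coloring the leftover tuples *)

(** Take [s] with the fewest bad places. If [b] is bad, at most [2 * m] choices of [b'] make a bad
    place when the images of [b] and [b'] are exchanged, so some exchange lowers the number. *)
Lemma swap_perm (T : finType) (J : {set T}) (bad : rel T) (m : nat) :
  (forall a, #|[set b in J | bad a b]| <= m)%N ->
  (forall b, #|[set a in J | bad a b]| <= m)%N ->
  (2 * m < #|J|)%N ->
  exists2 s : {perm T}, perm_on J s & forall b, b \in J -> ~~ bad (s b) b.
Proof.
move=> mr mc mJ.
pose bd (s : {perm T}) := [set b in J | bad (s b) b].
have [s sJ smin] := @arg_minnP _ (1%g : {perm T}) (fun s => perm_on J s)
  (fun s => #|bd s|) (perm_on1 J).
exists s => // b bJ; apply/negP => bb.
pose B1 := [set b' in J | bad (s b') b].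
pose B2 := [set b' in J | bad (s b) b'].
have cB1 : (#|B1| <= m)%N.
  rewrite -(card_imset _ (@perm_inj _ s)); apply: leq_trans (mc b).
  apply: subset_leq_card; apply/fintype.subsetP => _ /imsetP[b' + ->].
  by rewrite !inE => /andP[b'J ->]; rewrite (perm_closed _ sJ) b'J.
have /subsetPn[b' b'J] : ~~ (J \subset B1 :|: B2).
  apply/negP => /subset_leq_card /leq_trans/(_ (leq_card_setU _ _)).
  have := mr (s b); rewrite -/B2; lia.
rewrite !inE b'J /= negb_or => /andP[n1 n2].
pose s' := (tperm b b' * s)%g.
have s'J : perm_on J s'.
  apply: perm_onM => //; apply/fintype.subsetP => x; rewrite inE => hx.
  by have := hx; case: tpermP => [->|->|_ _ /eqP].
have := smin s' s'J; rewrite leqNgt => /negP; apply.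
apply: proper_card; apply/properP; split; last first.
  by exists b; rewrite !inE ?bJ ?bb//= permM tpermL n1.
apply/fintype.subsetP => x; rewrite !inE permM => /andP[-> /=].
case: tpermP => [->|->|//]; [by rewrite (negbTE n1)|by rewrite (negbTE n2)].
Qed.

(* Greedy coloring: by averaging some tuple of A meets few of the edges inside
   A, and it is colored last. *)
Lemma degenerate_coloring (I T : finType) (i0 : I) (G : {set {ffun I -> T}})
    (A : {set T}) (D : nat) :
  (forall A' : {set T}, A' \subset A ->
     #|G :&: box (fun=> A')| <= D * #|A'|)%N ->
  (forall j, j \in A -> [ffun=> j] \notin G) ->
  exists c : T -> 'I_(#|I| * D).+1, forall (g : {ffun I -> T}) l, g \in G ->
    (forall i, g i \in A) -> ~ (forall i, c (g i) = l).
Proof.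
move=> + nc; move: {2}#|A| (leqnn #|A|) => k.
elim: k A nc => [|k IH] A nc Ak dA.
  exists (fun=> ord0) => g l _ gA; have := gA i0.
  by move: Ak; rewrite leqn0 cards_eq0 => /eqP->; rewrite inE.
have [A0|/set0Pn[a aA]] := eqVneq A finset.set0.
  by apply: IH => //; rewrite A0 cards0.
set GA := G :&: box (fun=> A).
pose N j := [set g in GA | [exists i, g i == j]].
have [j jA Nj] : exists2 j, j \in A & (#|N j| <= #|I| * D)%N.
  apply: contrapT => no.
  have : (\sum_(j in A) (#|I| * D).+1 <= \sum_(j in A) #|N j|)%N.
    apply: leq_sum => j jA; rewrite ltnNge; apply/negP => h.
    by apply: no; exists j.
  rewrite sum_nat_const leqNgt => /negP; apply.
  apply: leq_ltn_trans (_ : #|A| * (#|I| * D) < _)%N; last first.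
    by rewrite ltn_pmul2l//; apply/card_gt0P; exists a.
  apply: leq_trans (_ : \sum_(g in GA) #|I| <= _)%N; last first.
    by rewrite sum_nat_const mulnC mulnCA leq_mul2l mulnC dA ?orbT.
  under eq_bigr => j _ do rewrite -sum1_card big_mkcond.
  rewrite exchange_big [leqRHS]big_mkcond; apply: leq_sum => g _ /=.
  case gGA : (g \in GA); last first.
    by rewrite big1// => j _; rewrite inE gGA.
  rewrite -[X in (_ <= X)%N]cardsT.
  apply: leq_trans (_ : #|[set g i | i in [set: I]]| <= _)%N; last first.
    exact: leq_imset_card.
  rewrite -sum1_card big_mkcond [leqRHS]big_mkcond /=; apply: leq_sum => j _.
  case: ifP => // _; rewrite inE gGA /=; case: existsP => // -[i /eqP <-].
  by rewrite imset_f ?inE.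
have [] := IH (A :\ j).
- by move=> b; rewrite inE => /andP[_ /nc].
- by move: Ak; rewrite (cardsD1 j) jA.
- by move=> A' /fintype.subset_trans A'A; apply: dA; apply: A'A; apply: subD1set.
move=> c cP.
(* A coordinate where [g] differs from [j]: it exists for edges in [N j], the constant function [j]
   not being in [G]. It suffices that the color of [j] differs from the color there, which forbids
   at most [#|I| * D] colors. *)
pose other (g : {ffun I -> T}) := odflt i0 [pick i | g i != j].
pose forb := [set c ((g : {ffun I -> T}) (other g)) | g in N j].
have /subsetPn[l0 _ l0P] : ~~ ([set: 'I_(#|I| * D).+1] \subset forb).
  apply/negP => /subset_leq_card; rewrite cardsT card_ord ltnNge.
  by rewrite (leq_trans (leq_imset_card _ _)).
exists (fun v => if v == j then l0 else c v) => g l gG gA cl.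
have [[i gi]|no] := pselect (exists i, g i = j); last first.
  apply: (cP g l gG) => i.
    by rewrite !inE gA andbT; apply/eqP => gi; apply: no; exists i.
  by have := cl i; case: eqP => // gi; case: no; exists i.
have gN : g \in N j.
  rewrite !inE gG /=; apply/andP; split; first by apply/forallP.
  by apply/existsP; exists i; rewrite gi.
have og : g (other g) != j.
  rewrite /other; case: pickP => // allj; have := nc j jA.
  rewrite (_ : [ffun=> j] = g) ?gG//; apply/ffunP => i'; rewrite ffunE.
  by have := allj i' => /negbFE/eqP.
have := cl (other g); rewrite (negbTE og) -(cl i) gi eqxx => cg.
by move/negP: l0P; apply; rewrite -cg; apply/imsetP; exists g.
Qed.

Definition good_full (I T C : finType) (S : {set {ffun I -> T}})
    (pi : {ffun I -> {perm T}}) (c : T -> C) :=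
  forall (g : {ffun I -> T}) l, (forall i, c (g i) = l) ->
  tuple_edge pi g \notin S.

(** The uncolored tuples, with some colored ones, form a set [J] of exactly [s] tuples, large enough
    to rearrange part [i0] inside [J] until no tuple of [J] is an edge. The tuples of [J] are then
    colored greedily with fresh colors. *)
Lemma extend_coloring (I T C : finType) (i0 i1 : I) (S : {set {ffun I -> T}})
    (s m D : nat) (c0 : C) :
  i0 != i1 ->
  (forall i v, #|[set f in S | f i == v]| <= m)%N ->
  (forall W : I -> {set T}, forall w, (w <= s)%N -> (forall i, #|W i| = w) ->
    #|S :&: box W| <= D * w)%N ->
  (2 * m < s)%N -> (s <= #|T|)%N -> (#|T| <= max_colored C S + s)%N ->
  exists pi, exists c : T -> C + 'I_(#|I| * D).+1, good_full S pi c.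
Proof.
move=> i01 degS densS ms sT colS.
have [[pi c] gx mx] := max_coloredP C i0 S.
have [J [UJ cJ]] : exists J : {set T}, ~: colored c \subset J /\ #|J| = s.
  have cU : (#|~: colored c| <= s)%N.
    by have := cardsC (colored c); rewrite mx /= in colS *; lia.
  have sU : (s - #|~: colored c| <= #|colored c|)%N.
    by have := cardsC (colored c); lia.
  pose E := [set x in take (s - #|~: colored c|) (enum (colored c))].
  have EU : [disjoint ~: colored c & E].
    apply/pred0P => x /=; rewrite finset.in_setC [x \in E]inE.
    by apply/negP => /andP[xU /mem_take]; rewrite mem_enum (negbTE xU).
  have cE : #|E| = (s - #|~: colored c|)%N.
    rewrite cardsE (card_uniqP _) ?take_uniq ?enum_uniq//.
    by rewrite size_takel// -cardE.
  exists (~: colored c :|: E); split; first exact: finset.subsetUl.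
  by move: EU; rewrite -(leq_card_setU _ _) => /eqP ->; rewrite cE subnKC.
(* The tuple [b] with its vertex in part [i0] taken from the tuple [a]. Fixing [a] fixes the vertex
   in [i0], fixing [b] the one in [i1], so the degree bound limits the bad pairs on either side. *)
pose mix a b : {ffun I -> T} := [ffun i => if i == i0 then pi i0 a else pi i b].
pose bad a b := mix a b \in S.
have [|||t tJ tgood] := @swap_perm T J bad m; rewrite ?cJ//.
- move=> a; have mi : injective (mix a).
    move=> b b' /ffunP/(_ i1); rewrite !ffunE eq_sym (negbTE i01).
    exact: perm_inj.
  rewrite -(card_imset _ mi); apply: leq_trans (degS i0 (pi i0 a)).
  apply: subset_leq_card; apply/fintype.subsetP => _ /imsetP[b + ->].
  by rewrite inE => /andP[_ ab]; rewrite inE ffunE !eqxx andbT.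
- move=> b; have mi : injective (mix^~ b).
    by move=> a a' /ffunP/(_ i0); rewrite !ffunE eqxx; exact: perm_inj.
  rewrite -(card_imset _ mi); apply: leq_trans (degS i1 (pi i1 b)).
  apply: subset_leq_card; apply/fintype.subsetP => _ /imsetP[a + ->].
  by rewrite inE => /andP[_ ab]; rewrite inE ffunE (eq_sym i1) (negbTE i01) eqxx andbT.
pose pi' : {ffun I -> {perm T}} :=
  [ffun i => if i == i0 then (t * pi i0)%g else pi i].
pose G := [set g | tuple_edge pi' g \in S].
have [||d dP] := @degenerate_coloring I T i0 G J D.
- move=> A AJ; pose W i := [set pi' i x | x in A].
  have cW i : #|W i| = #|A| by rewrite card_imset//; exact: perm_inj.
  have As : (#|A| <= s)%N by rewrite -cJ subset_leq_card.
  apply: leq_trans (densS W _ As cW); rewrite -(card_imset _ (@tuple_edge_inj _ _ pi')).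
  apply: subset_leq_card; apply/fintype.subsetP => _ /imsetP[g + ->].
  rewrite !inE => /andP[-> /forallP gA] /=; apply/forallP => i.
  by rewrite ffunE imset_f.
- move=> j jJ; rewrite inE.
  suff -> : tuple_edge pi' [ffun=> j] = mix (t j) j by exact: tgood.
  by apply/ffunP => i; rewrite !ffunE; have [_|//] := eqVneq i i0; rewrite permM.
(* All uncolored tuples lie in [J], so the default [c0] is never taken. *)
pose c' (j : T) : C + 'I_(#|I| * D).+1 :=
  if j \in J then inr (d j) else inl (odflt c0 (c j)).
exists pi', c' => g [l|l] gl; last first.
  apply/negP => gS; apply: (dP g l); rewrite ?inE//.
    by move=> i; have := gl i; rewrite /c'; case: ifP.
  by move=> i; have := gl i; rewrite /c'; case: ifP => // _ [].
have gJ i : g i \notin J by have := gl i; rewrite /c'; case: ifP.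
have -> : tuple_edge pi' g = tuple_edge pi g.
  apply/ffunP => i; rewrite !ffunE; have [->|//] := eqVneq i i0.
  by rewrite permM (out_perm tJ).
have := forallP (forallP gx g) l => /implyP; apply; apply/forallP => i /=.
have := gl i; rewrite /c' (negbTE (gJ i)) => -[].
have : g i \notin ~: colored c.
  by apply: contra (gJ i) => h; apply: (fintype.subsetP UJ).
by rewrite !inE negbK; case: (c (g i)) => //= a _ ->.
Qed.

(** * Back to the random hypergraph *)

Definition edge_of (r n : nat) (f : {ffun 'I_r -> 'I_n}) :
  {set 'I_n * 'I_r} := [set (f i, i) | i : 'I_r].

(** A vertex takes the color of its tuple; as each tuple has one vertex in every part, each color
    class meets all parts equally often. *)
Lemma balanced_colorable_good (r n : nat) (C : finType)
    (S : {set {ffun 'I_r -> 'I_n}}) pi (c : 'I_n -> C) :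
  good_full S pi c ->
  balanced_colorable (@part r n)
    [set edge_of f | f in S] #|C|.
Proof.
move=> good.
pose phi : {ffun 'I_n * 'I_r -> 'I_#|C|} :=
  [ffun v => enum_rank (c ((pi v.2)^-1%g v.1))].
apply/existsP; exists phi; apply/andP; split; apply/forallP => l.
  apply/forall_inP => _ /imsetP[f fS ->]; apply/negP => /fintype.subsetP sub.
  pose g : {ffun 'I_r -> 'I_n} := [ffun i => (pi i)^-1%g (f i)].
  have gl i : c (g i) = enum_val l.
    have : (f i, i) \in phi @^-1: [set l].
      by apply: sub; apply/imsetP; exists i.
    by rewrite !inE !ffunE /= => /eqP <-; rewrite enum_rankK.
  have := good g _ gl; rewrite (_ : tuple_edge pi g = f) ?fS//.
  by apply/ffunP => i; rewrite !ffunE permKV.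
have card_i i : #|phi @^-1: [set l] :&: part n i| =
    #|[set j | c j == enum_val l]|.
  have inj : injective (fun j => (pi i j, i)).
    by move=> j j' [] /perm_inj.
  rewrite -(card_imset _ inj); apply: eq_card => -[v i']; rewrite !inE ffunE /=.
  apply/andP/imsetP => [[/eqP <- /eqP ->]|[j + [-> ->]]].
    by exists ((pi i)^-1%g v); rewrite ?inE ?enum_rankK// permKV.
  by rewrite inE permK => /eqP ->; rewrite enum_valK !eqxx.
by apply/forallP => i; apply/forallP => i'; rewrite !card_i.
Qed.

Lemma edge_of_inj (r n : nat) : injective (@edge_of r n).
Proof.
move=> f g /setP fg; apply/ffunP => i.
have : (f i, i) \in edge_of f by apply/imsetP; exists i.
by rewrite fg => /imsetP[j _ [-> <-]].
Qed.

(** The injection [edge_of] identifies sets of functions with subsets of [transversals] and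
    preserves the product weights. *)
Lemma hypergraph_PrE (R : realType) (r n : nat) (p : R)
    (event : {set {set 'I_n * 'I_r}} -> bool) :
  hypergraph_Pr p event =
  rs_Pr p (fun S : {set {ffun 'I_r -> 'I_n}} => event [set edge_of f | f in S]).
Proof.
have imK (S : {set {ffun 'I_r -> 'I_n}}) :
    [set f | edge_of f \in [set edge_of f | f in S]] = S.
  by apply/setP => f; rewrite inE mem_imset//; exact: edge_of_inj.
have trE : transversals r n = [set edge_of f | f : {ffun 'I_r -> 'I_n}] by [].
rewrite /hypergraph_Pr (reindex_onto
  (fun S : {set {ffun 'I_r -> 'I_n}} => [set edge_of f | f in S])
  (fun E => [set f | edge_of f \in E])) /=; last first.
  move=> E /andP[]; rewrite powersetE => /fintype.subsetP ET _.
  apply/setP => e; apply/imsetP/idP => [[f]|eE].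
    by rewrite inE => + ->.
  have /imsetP[f _ ef] := ET e eE; exists f => //.
  by rewrite inE; move: eE; rewrite ef.
rewrite /rs_Pr /rs_E big_mkcond; apply: eq_bigr => S _.
rewrite imK eqxx andbT powersetE.
have -> /= : [set edge_of f | f in S] \subset transversals r n.
  by apply/fintype.subsetP => _ /imsetP[f _ ->]; apply/imsetP; exists f.
case: ifP => _; rewrite ?mulr0 ?mulr1//.
rewrite /hypergraph_weight trE big_imset/=; last first.
  by move=> f g _ _; exact: edge_of_inj.
apply: eq_big => // f _; rewrite mem_imset//; exact: edge_of_inj.
Qed.

Lemma balanced_chromatic_number_bounds (R : realType) (V : finType) (r : nat)
    (Vs : 'I_r -> {set V}) (E : {set {set V}}) (L U : R) :
  (exists2 q, balanced_colorable Vs E q & q%:R <= U) ->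
  (forall q, balanced_colorable Vs E q -> L <= q%:R) ->
  (L%:E <= balanced_chromatic_number R Vs E)%E &&
  (balanced_chromatic_number R Vs E <= U%:E)%E.
Proof.
move=> [q qE qU] low; rewrite /balanced_chromatic_number.
case: pselect => [ex|no]; last by case: no; exists q.
case: ex_minnP => q' q'E q'min; rewrite !lee_fin low//=.
by apply: le_trans qU; rewrite ler_nat q'min.
Qed.

(** * Edge-free boxes and union bounds *)

Definition free_box (I T : finType) (k : nat) (S : {set {ffun I -> T}}) : bool :=
  [exists W : {ffun I -> {set T}},
    (W \in box (fun=> [set A : {set T} | #|A| == k])) &&
    [disjoint box W & S]].

(** A balanced class with [k] vertices in one part contains a box of side [k], hence an edge. So
    every class has at most [k.-1] vertices in the first part. *)
Lemma balanced_colorable_lower (r n q k : nat)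
    (S : {set {ffun 'I_r -> 'I_n}}) :
  (0 < r)%N -> (0 < k)%N -> ~~ free_box k S ->
  balanced_colorable (@part r n) [set edge_of f | f in S] q ->
  (n <= q * k.-1)%N.
Proof.
case: r S => // r S _ k0 /existsPn nfree /existsP[phi /andP[/forallP pr /forallP bal]].
pose P i c := [set v : 'I_n | phi (v, i) == c].
have cP i c : #|P i c| = #|phi @^-1: [set c] :&: part n i|.
  have inj : injective (fun v : 'I_n => (v, i)) by move=> v v' [].
  rewrite -(card_imset _ inj); apply: eq_card => -[v j]; rewrite !inE /=.
  apply/imsetP/andP => [[u + [-> ->]]|[pv /eqP ji]]; first by rewrite inE eqxx.
  by rewrite ji in pv *; exists v; rewrite ?inE.
have Pk c : (#|P ord0 c| <= k.-1)%N.
  rewrite -ltnS prednK// ltnNge; apply/negP => kP.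
  have kPi i : (k <= #|P i c|)%N.
    by rewrite cP -(eqP (forallP (forallP (bal c) ord0) i)) -cP.
  pose W : {ffun 'I_r.+1 -> {set 'I_n}} :=
    [ffun i => [set v in take k (enum (P i c))]].
  have := nfree W; rewrite negb_and => /orP[/negP|/pred0Pn[f /andP[+ fS]]].
    apply; rewrite inE; apply/forallP => i; rewrite inE ffunE cardsE.
    by rewrite (card_uniqP _) ?take_uniq ?enum_uniq// size_takel// -cardE.
  rewrite /= inE => /forallP fW.
  have /forall_inP/(_ (edge_of f)) := pr c.
  rewrite imset_f// => /(_ isT)/negP; apply.
  apply/fintype.subsetP => _ /imsetP[i _ ->]; rewrite !inE.
  by have := fW i; rewrite ffunE inE => /mem_take; rewrite mem_enum inE.
rewrite -[n]card_ord -(sum_cls [ffun v => phi (v, ord0)]).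
apply: leq_trans (_ : \sum_(c < q) k.-1 <= _)%N; last first.
  by rewrite sum_nat_const card_ord.
apply: leq_sum => c _; apply: leq_trans (Pk c).
by apply: subset_leq_card; apply/fintype.subsetP => v; rewrite !inE ffunE.
Qed.

Lemma Pr_free_box (R : realType) (I T : finType) (p : R) (k : nat) :
  0 <= p <= 1 ->
  rs_Pr p (free_box (I := I) (T := T) k) <=
    'C(#|T|, k)%:R ^+ #|I| * (1 - p) ^+ (k ^ #|I|).
Proof.
move=> p01.
pose Q : {set {ffun I -> {set T}}} := box (fun=> [set A : {set T} | #|A| == k]).
apply: le_trans (rs_Pr_bigor (mem Q) _ p01) _.
rewrite (eq_bigr (fun=> (1 - p) ^+ (k ^ #|I|))) => [|W].
  by rewrite sumr_const card_box prod_nat_const card_draws -natrX mulr_natl.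
rewrite /Q => /= WQ; rewrite rs_Pr_disjoint card_box (eq_bigr (fun=> k)).
  by rewrite prod_nat_const.
by move=> i _; move: WQ; rewrite inE => /forallP/(_ i); rewrite inE => /eqP.
Qed.

Lemma Pr_many_edges (R : realType) (F : finType) (p : R) (B : {set F}) (k : nat) :
  0 <= p <= 1 ->
  rs_Pr p (fun S => k <= #|S :&: B|)%N <= 'C(#|B|, k)%:R * p ^+ k.
Proof.
move=> p01.
pose Q := [set A : {set F} | (A \subset B) && (#|A| == k)].
apply: le_trans (_ : rs_Pr p (fun S => [exists (A | A \in Q), A \subset S]) <= _).
  apply: le_rs_Pr => // S kS.
  pose A := [set e in take k (enum (S :&: B))].
  have AS e : e \in A -> e \in S :&: B by rewrite inE => /mem_take; rewrite mem_enum.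
  apply/existsP; exists A; apply/andP; split; last first.
    by apply/fintype.subsetP => e /AS; rewrite inE => /andP[].
  rewrite inE; apply/andP; split.
    by apply/fintype.subsetP => e /AS; rewrite inE => /andP[].
  by rewrite cardsE (card_uniqP _) ?take_uniq ?enum_uniq// size_takel// -cardE.
apply: le_trans (rs_Pr_bigor (mem Q) _ p01) _.
rewrite (eq_bigr (fun=> p ^+ k)) => [|A].
  by rewrite sumr_const cards_draws mulr_natl.
by rewrite /= inE => /andP[_ /eqP <-]; rewrite rs_Pr_sub.
Qed.

(** * Estimates *)

(** The quotient of [b ^ b] by the factorial of [b] is one term of the series of [exp b]. *)
Lemma pow_le_fact_expR (R : realType) (b : nat) :
  (b ^ b)%:R <= (b`!)%:R * expR 1 ^+ b :> R.
Proof.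
case: b => [|b]; first by rewrite expr0 fact0 expn0 mulr1.
rewrite -expRM_natr mul1r.
have h := expR_ge1Dxn b (ler0n R b.+1).
rewrite mulrC -ler_pdivrMr ?ltr0n ?fact_gt0// natrX.
by apply: le_trans h; rewrite lerDr.
Qed.

Lemma bin_le (R : realType) (a b : nat) :
  'C(a, b)%:R <= (expR 1 * a%:R / b%:R) ^+ b :> R.
Proof.
have [->|b0] := posnP b; first by rewrite bin0 expr0.
have f0 : 0 < (b`!)%:R :> R by rewrite ltr0n fact_gt0.
rewrite expr_div_n ler_pdivlMr ?exprn_gt0 ?ltr0n//.
rewrite -natrX; apply: le_trans (ler_wpM2l (ler0n _ _) (pow_le_fact_expR R b)) _.
rewrite mulrA -natrM bin_ffact exprMn mulrC ler_wpM2l ?exprn_ge0 ?expR_ge0//.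
rewrite -natrX ler_nat ffact_prod -[X in (_ <= _ ^ X)%N]card_ord -prod_nat_const.
by apply: leq_prod => i _; exact: leq_subr.
Qed.

Lemma ln_pow_le (R : realType) (K : R) (m : nat) :
  exists Y : R, 1 <= Y /\ forall y, Y <= y -> K * ln y ^+ m <= y.
Proof.
(* Beyond this threshold [K * ln y ^+ m] is at most the term of degree [m.+1] in the series of
   [exp (ln y)]. *)
pose U := `|K| * (m.+1)`!%:R; exists (expR U); split.
  by rewrite -expR0 ler_expR mulr_ge0.
move=> y Uy; have y0 : 0 < y by apply: lt_le_trans Uy; exact: expR_gt0.
have Ul : U <= ln y by rewrite -[U]expRK ler_ln ?posrE ?expR_gt0.
have l0 : 0 <= ln y by apply: le_trans Ul; rewrite mulr_ge0.
apply: le_trans (_ : `|K| * ln y ^+ m <= _).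
  by rewrite ler_wpM2r ?exprn_ge0 ?ler_norm.
have := expR_ge1Dxn m l0; rewrite lnK ?posrE// => h.
apply: le_trans h; apply: le_trans (_ : ln y ^+ m.+1 / m.+1`!%:R <= _).
  rewrite ler_pdivlMr ?ltr0n ?fact_gt0// exprS mulrAC.
  by rewrite ler_wpM2r ?exprn_ge0.
by rewrite lerDr.
Qed.

(** That [ln u / u] decreases for [u >= e] follows from [ln (q / u) <= q / u - 1] and
    [ln u >= 1]. *)
Lemma ln_ratio_le (R : realType) (u q : R) :
  expR 1 <= u -> u <= q -> u * ln q <= q * ln u.
Proof.
move=> eu uq; have u0 : 0 < u by apply: lt_le_trans eu; exact: expR_gt0.
have q0 : 0 < q by apply: lt_le_trans uq.
have l1 : 1 <= ln u by rewrite -[leLHS](expRK (1 : R)) ler_ln ?posrE ?expR_gt0.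
have h : ln (q / u) <= q / u - 1.
  have := @le_ln1Dx R (q / u - 1); rewrite subrKC; apply.
  by rewrite ltrBrDr addNr divr_gt0.
rewrite ln_div ?posrE// in h.
have uq1 : 0 <= q / u - 1 by rewrite subr_ge0 ler_pdivlMr// mul1r.
have : ln q <= q / u * ln u by nra.
by rewrite -(ler_pM2l u0) mulrA mulrCA divff ?gt_eqF// mulr1 [in X in _ -> X]mulrC
  [in X in _ -> X]mulrC.
Qed.

(* k ln (q k / s) - k + s / q is nonnegative, vanishing at k = s / q. Up to
   k = A s / q the left-hand side is absorbed by delta k; beyond, by the
   logarithm, as ln u / u decreases for u >= e. *)
Lemma overlap_pointwise (R : realType) (r q s k : nat) (b e1 : R) :
  (2 <= r)%N -> (0 < q)%N -> (k <= s)%N -> 0 < e1 < 1 -> 0 <= b ->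
  b * s%:R ^+ r.-1 <= (1 - e1) * ln q%:R ->
  b * k%:R ^+ r <= ln q%:R * (expR e1^-1 / q%:R) ^+ r.-1 * k%:R +
    k%:R * ln (q%:R * k%:R / s%:R) - k%:R + s%:R / q%:R.
Proof.
case: r => [//|r] r2 q0 ks /andP[e10 e11] b0 /= hb.
have [->|k0] := posnP k.
  by rewrite expr0n /= !mulr0 !mul0r subr0 !add0r divr_ge0.
have s0 : (0 < s)%N by apply: leq_trans ks.
have kR : 0 < k%:R :> R by rewrite ltr0n.
have sR : 0 < s%:R :> R by rewrite ltr0n.
have qR : 0 < q%:R :> R by rewrite ltr0n.
have lq : 0 <= ln q%:R :> R by rewrite ln_ge0// ler1n.
set A := expR e1^-1; set x : R := k%:R / s%:R.
have x0 : 0 < x by rewrite divr_gt0.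
have x1 : x <= 1 by rewrite ler_pdivrMr// mul1r ler_nat.
have -> : q%:R * k%:R / s%:R = q%:R * x by rewrite mulrA.
set u := q%:R * x; have u0 : 0 < u by rewrite mulr_gt0.
have kE : k%:R = s%:R * x by rewrite mulrCA divff ?mulr1// gt_eqF.
have -> : b * k%:R ^+ r.+1 = (b * s%:R ^+ r) * x ^+ r * k%:R.
  by rewrite exprSr {1}kE exprMn !mulrA.
have sq : s%:R / q%:R = k%:R / u.
  by rewrite /u kE -mulf_div divff ?mulr1// gt_eqF.
rewrite sq.
have hb' : (b * s%:R ^+ r) * x ^+ r * k%:R <=
    (1 - e1) * ln q%:R * x ^+ r * k%:R.
  by rewrite ler_wpM2r ?(ltW kR)// ler_wpM2r ?exprn_ge0 ?(ltW x0).
apply: le_trans hb' _.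
have [uA|uA] := leP u A.
  have t1 : (1 - e1) * ln q%:R * x ^+ r * k%:R <=
      ln q%:R * (A / q%:R) ^+ r * k%:R.
    rewrite ler_wpM2r ?(ltW kR)//; apply: ler_pM.
    - by rewrite mulr_ge0// subr_ge0 ltW.
    - by rewrite exprn_ge0 ?ltW.
    - by rewrite ler_piMl// gerBl ltW.
    rewrite lerXn2r ?nnegrE ?divr_ge0 ?expR_ge0 ?(ltW x0)//.
    by rewrite ler_pdivlMr// mulrC.
  have t2 : 0 <= k%:R * (ln u - 1 + u^-1).
    rewrite mulr_ge0 ?(ltW kR)//.
    have um1 : -1 < u^-1 - 1 by rewrite ltrBrDr addNr invr_gt0.
    by have := le_ln1Dx um1; rewrite subrKC lnV ?posrE//; lra.
  have -> : k%:R * ln u = k%:R * (ln u - 1 + u^-1) + k%:R - k%:R / u by ring.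
  by move: t1 t2; move: (_ * _ * k%:R) (_ * _ * k%:R) (_ * (_ + _)) (k%:R / u) => ? ? ? ?; lra.
(* [A] is chosen so that [e1 * ln u >= 1] from here on: the factor [1 - e1] then pays for the term
   [- k]. *)
have Ae : expR 1 <= A by rewrite ler_expR invf_ge1// ltW.
have uq : u <= q%:R by rewrite ler_piMr// ltW.
have lu : e1^-1 <= ln u.
  by rewrite -[leLHS]expRK ler_ln ?posrE ?expR_gt0// ltW.
have h := ln_ratio_le (le_trans Ae (ltW uA)) uq.
have xr : x ^+ r <= x by rewrite -[leRHS]expr1 ler_wiXn2l// ltW.
have t1 : (1 - e1) * ln q%:R * x ^+ r <= (1 - e1) * ln u.
  rewrite -mulrA ler_wpM2l ?subr_ge0 ?(ltW e11)//.
  apply: le_trans (ler_wpM2l lq xr) _.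
  by rewrite -(ler_pM2l qR) mulrCA -/u mulrC.
have t2 : (1 - e1) * ln u <= ln u - 1.
  have : 1 <= e1 * ln u by rewrite -ler_pdivrMl// mulr1.
  by rewrite mulrBl mul1r; lra.
have t3 : (1 - e1) * ln q%:R * x ^+ r * k%:R <= (ln u - 1) * k%:R.
  by rewrite ler_wpM2r ?(ltW kR)// (le_trans t1).
apply: le_trans t3 _.
have d0 : 0 <= ln q%:R * (A / q%:R) ^+ r * k%:R.
  by rewrite !mulr_ge0 ?exprn_ge0 ?divr_ge0 ?expR_ge0.
have ku : 0 <= k%:R / u by rewrite divr_ge0 ?ltW.
have -> : (ln u - 1) * k%:R = k%:R * ln u - k%:R by ring.
by move: d0 ku; move: (_ * _ * k%:R) (k%:R / u) (k%:R * _) => ? ? ?; lra.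
Qed.

(** By [bin_le] and [1 - p <= exp (- p)], the logarithm of the union bound is at most [k] times the
    left-hand side of the last hypothesis. *)
Lemma Pr_free_box_exp (R : realType) (I T : finType) (p : R) (k : nat) :
  0 <= p <= 1 -> (0 < #|I|)%N -> (0 < #|T|)%N -> (0 < k)%N ->
  #|I|%:R * (1 + ln (#|T|%:R / k%:R)) - p * k%:R ^+ #|I|.-1 <= -1 ->
  rs_Pr p (free_box (I := I) (T := T) k) <= expR (- k%:R).
Proof.
move=> p01 I0 T0 k0 h; apply: le_trans (Pr_free_box _ _ _ p01) _.
have [p0 p1] := andP p01.
have kR : 0 < k%:R :> R by rewrite ltr0n.
have nk : 0 < #|T|%:R / k%:R :> R by rewrite divr_gt0 ?ltr0n.
have b1 : 'C(#|T|, k)%:R ^+ #|I| <=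
    expR (k%:R * (#|I|%:R * (1 + ln (#|T|%:R / k%:R)))) :> R.
  rewrite mulrCA mulrC expRM_natr lerXn2r ?nnegrE ?expR_ge0//.
  apply: le_trans (bin_le _ _ _) _.
  by rewrite (mulrC k%:R) expRM_natr expRD lnK ?posrE// mulrA.
have b2 : (1 - p) ^+ (k ^ #|I|) <= expR (- (k%:R * (p * k%:R ^+ #|I|.-1))).
  have -> : k%:R * (p * k%:R ^+ #|I|.-1) = p * (k ^ #|I|)%:R.
    by rewrite mulrCA -exprS prednK// natrX.
  rewrite -mulNr expRM_natr lerXn2r ?nnegrE ?expR_ge0 ?subr_ge0//.
  exact: expR_ge1Dx.
apply: le_trans (ler_pM _ _ b1 b2) _; rewrite ?exprn_ge0 ?subr_ge0//.
rewrite -expRD ler_expR -mulrBr -[leRHS]mulrN1.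
by rewrite ler_wpM2l// ltW.
Qed.

Lemma sum_half_pow (R : realType) (s : nat) :
  \sum_(w < s.+1 | (0 < w)%N) (2^-1 : R) ^+ w <= 1.
Proof.
rewrite big_mkcond big_ord_recl /= add0r.
have -> : \sum_(i < s) 2^-1 ^+ bump 0 i = 1 - 2^-1 ^+ s :> R.
  elim: s => [|s IH]; first by rewrite big_ord0 expr0 subrr.
  by rewrite big_ord_recr IH /= /bump /= add1n exprS; field.
by rewrite gerBl exprn_ge0// invr_ge0.
Qed.

(** * Probabilities of the exceptional events *)

Definition dense_box (I T : finType) (D s : nat) (S : {set {ffun I -> T}}) :=
  [exists w : 'I_s.+1, (0 < w)%N &&
    [exists W : {ffun I -> {set T}},
      (W \in box (fun=> [set A : {set T} | #|A| == w])) &&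
      (D * w <= #|S :&: box W|)%N]].

(** In the union bound, side [w] contributes at most the [w]-th power of the left-hand side of the
    hypothesis. With [n = #|T|] this is at most [(w / 4n)^w <= (w / n) 4^-w <= 2^-w / n], which is
    summed over [w]. *)
Lemma Pr_dense_box (R : realType) (I T : finType) (p : R) (D s : nat) :
  0 <= p <= 1 -> (0 < D)%N -> (s <= #|T|)%N ->
  (forall w, (0 < w <= s)%N ->
    (expR 1 * #|T|%:R / w%:R) ^+ #|I| *
    (expR 1 * w%:R ^+ #|I| * p / (D%:R * w%:R)) ^+ D <= w%:R / #|T|%:R / 4) ->
  rs_Pr p (dense_box (I := I) (T := T) D s) <= #|T|%:R^-1.
Proof.
move=> p01 D0 sT h; have [p0 p1] := andP p01.
apply: le_trans (rs_Pr_bigor (fun w : 'I_s.+1 => (0 < w)%N) _ p01) _.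
apply: le_trans (_ : #|T|%:R^-1 * \sum_(w < s.+1 | (0 < w)%N) (2^-1 : R) ^+ w <= _);
  last by rewrite ler_piMr ?invr_ge0 ?sum_half_pow.
rewrite mulr_sumr; apply: ler_sum => w w0.
have ws : (w <= s)%N by rewrite -ltnS.
have T0 : (0 < #|T|)%N by apply: leq_trans sT; apply: leq_trans ws.
have wR : 0 < (w : nat)%:R :> R by rewrite ltr0n.
have TR : 0 < #|T|%:R :> R by rewrite ltr0n.
have DR : 0 < D%:R :> R by rewrite ltr0n.
pose Q : {set {ffun I -> {set T}}} :=
  box (fun=> [set A : {set T} | #|A| == w]).
apply: le_trans (rs_Pr_bigor (mem Q) _ p01) _.
apply: le_trans (_ : \sum_(W in Q)
  'C(w ^ #|I|, D * w)%:R * p ^+ (D * w) <= _).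
  apply: ler_sum => W WQ; apply: le_trans (Pr_many_edges _ _ p01) _.
  rewrite card_box (eq_bigr (fun=> w : nat)) ?prod_nat_const// => i _.
  by move: WQ; rewrite /= inE => /forallP/(_ i); rewrite inE => /eqP.
rewrite sumr_const card_box prod_nat_const card_draws -[leLHS]mulr_natl natrX.
apply: le_trans (_ : ((w%:R / #|T|%:R / 4) ^+ w) <= _).
  have hw := h w; rewrite w0 ws in hw.
  apply: le_trans (lerXn2r w _ _ (hw isT)); rewrite ?nnegrE; last 2 first.
  - by rewrite !mulr_ge0 ?exprn_ge0 ?divr_ge0 ?mulr_ge0 ?exprn_ge0 ?expR_ge0.
  - by rewrite !divr_ge0.
  rewrite exprMn -!exprM (mulnC #|I|) (mulnC _ w).
  have -> : expR 1 * w%:R ^+ #|I| * p / (D%:R * w%:R) =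
      expR 1 * (w ^ #|I|)%:R / (D * w)%:R * p :> R.
    by rewrite natrX natrM mulrAC.
  rewrite (exprMn _ _ p) (mulnC w D); apply: ler_pM.
  - by rewrite exprn_ge0.
  - by rewrite mulr_ge0 ?exprn_ge0.
  - rewrite (mulnC _ #|I|) mulnC exprM.
    by rewrite lerXn2r ?nnegrE ?bin_le ?exprn_ge0 ?divr_ge0 ?mulr_ge0 ?expR_ge0.
  by rewrite ler_wpM2r ?exprn_ge0 ?bin_le.
have y1 : w%:R / #|T|%:R <= 1 :> R.
  by rewrite ler_pdivrMr// mul1r ler_nat (leq_trans ws).
rewrite exprMn; apply: le_trans (_ : w%:R / #|T|%:R * 4^-1 ^+ w <= _).
  rewrite ler_wpM2r ?exprn_ge0 ?invr_ge0//.
  by rewrite -[leRHS]expr1 ler_wiXn2l ?divr_ge0.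
rewrite [w%:R / _]mulrC -mulrA ler_wpM2l ?invr_ge0//.
have -> : 4^-1 = 2^-1 * 2^-1 :> R by field.
rewrite exprMn mulrA ler_piMl ?exprn_ge0 ?invr_ge0//.
by rewrite exprVn ler_pdivrMr ?exprn_gt0// mul1r -natrX ler_nat ltnW// ltn_expl.
Qed.

Definition high_degree (I T : finType) (m : nat) (S : {set {ffun I -> T}}) :=
  [exists v : I * T, m <= #|S :&: [set f : {ffun I -> T} | f v.1 == v.2]|]%N.

Lemma Pr_high_degree (R : realType) (I T : finType) (p : R) (m : nat) :
  0 <= p <= 1 ->
  rs_Pr p (high_degree (I := I) (T := T) m) <=
    (#|I| * #|T|)%:R * (expR 1 * (#|T|%:R ^+ #|I|.-1 * p) / m%:R) ^+ m.
Proof.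
move=> p01; have [p0 p1] := andP p01.
rewrite /high_degree.
apply: le_trans (rs_Pr_bigor predT _ p01) _.
rewrite -card_prod mulr_natl -sumr_const; apply: ler_sum => -[i v] _ /=.
apply: le_trans (Pr_many_edges _ _ p01) _.
have -> : #|[set f : {ffun I -> T} | f i == v]| = (#|T| ^ #|I|.-1)%N.
  pose W j := if j == i then [set v] else [set: T].
  transitivity #|box W|.
    apply: eq_card => f; rewrite !inE; apply/idP/forallP => [fv j|/(_ i)].
      by rewrite /W; case: eqP => [->|]; rewrite inE.
    by rewrite /W eqxx inE.
  rewrite card_box (bigD1 i)//= /W eqxx cards1 mul1n.
  rewrite (eq_bigr (fun=> #|T|)) => [|j /negbTE ->]; last by rewrite cardsT.
  by rewrite prod_nat_const cardC1.
apply: le_trans (ler_wpM2r (exprn_ge0 _ p0) (bin_le _ _ _)) _.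
rewrite -exprMn lerXn2r ?nnegrE ?mulr_ge0 ?invr_ge0 ?expR_ge0 ?exprn_ge0//.
by rewrite natrX mulrAC mulrA.
Qed.

(** The second moment bound for a popular equitable profile shows that full coverage has probability
    at least the inverse of the first factor. The tail bound, with one block of edges per vertex of
    part [i0], then limits poor coverage. *)
Lemma Pr_few_colored (R : realType) (I T C : finType) (p delta l eta : R) :
  (0 < #|I|)%N -> (0 < #|C|)%N -> 0 <= p < 1 -> 0 <= l <= 1 / 2 ->
  (forall s k, (k <= s)%N -> (#|C| * s.-1 <= #|T|)%N ->
     - ln (1 - p) / #|I|%:R * k%:R ^+ #|I| <= delta * k%:R +
     k%:R * ln (#|C|%:R * k%:R / s%:R) - k%:R + s%:R / #|C|%:R) ->
  rs_Pr p (fun S : {set {ffun I -> T}} =>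
      (max_colored C S)%:R <= #|T|%:R - eta :> R) <=
    (#|T|.+1%:R ^+ (#|C| ^ 2 + #|C|) * expR (delta * #|T|%:R)) ^+ #|I| *
    expR (4 * l ^+ 2 * #|T|%:R - l * eta).
Proof.
move=> I0 C0 p01 l01 hpt; have [i0 _] := card_gt0P I0.
have p01' : 0 <= p <= 1 by case/andP: p01 => -> /ltW.
have [m [mN meq]] := equitable_profile T C0.
set n := #|T| in mN hpt *; set q := #|C| in mN hpt *; set r := #|I| in hpt *.
have [t tm] : exists t : {ffun T -> C}, t \in prof_class T m.
  apply/card_gt0P; rewrite lt0n; apply: contraTneq mN => ->.
  by rewrite mul0n -ltnNge expn_gt0 C0.
have summ : (\sum_j m j = n)%N.
  rewrite -[n](sum_cls t); apply: eq_bigr => j _.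
  by move: tm; rewrite inE => /eqP <-; rewrite ffunE.
have hm j k : (k <= m j)%N -> - ln (1 - p) / r%:R * k%:R ^+ r <= delta * k%:R +
     k%:R * ln (q%:R * k%:R / (m j)%:R) - k%:R + (m j)%:R / q%:R.
  (* By equitability each of the [q] classes has at least [m j - 1] elements. *)
  move=> kmj; apply: hpt => //; rewrite -summ /q -sum_nat_const.
  by apply: leq_sum => i _; have := meq j i; lia.
have := @coloring_second_moment R I T C m p delta I0 p01 hm; rewrite -/n -/q -/r.
set P := rs_Pr p (has_mono_coloring _) => h.
set Y := _ ^+ (_ + _) * _.
have q0 : 0 < q%:R :> R by rewrite ltr0n.
have Y0 : 0 <= Y by rewrite mulr_ge0 ?exprn_ge0 ?expR_ge0.
have h1 : 1 <= Y ^+ r * P.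
  have qr : 0 < (q%:R ^+ n) ^+ r :> R by rewrite !exprn_gt0.
  rewrite -(ler_pM2l qr) mulr1.
  have NR : q%:R ^+ n <= #|prof_class T m|%:R * n.+1%:R ^+ q :> R.
    by rewrite -!natrX -natrM ler_nat.
  apply: le_trans (lerXn2r r _ _ NR) _; rewrite ?nnegrE ?mulr_ge0 ?exprn_ge0//.
  rewrite exprMn; apply: le_trans (ler_wpM2r _ h) _; rewrite ?exprn_ge0//.
  rewrite /Y exprD !exprMn le_eqVlt; apply/orP; left; apply/eqP.
  move: (n.+1%:R ^+ (q ^ 2) ^+ r) (n.+1%:R ^+ q ^+ r) (q%:R ^+ n ^+ r).
  by move: (expR _ ^+ r) => a b c d; ring.
have Pfull : P <= rs_Pr p (fun S : {set {ffun I -> T}} =>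
    n%:R <= (max_colored C S)%:R :> R).
  apply: le_rs_Pr => // S /(max_colored_mono i0); by rewrite ler_nat.
have tail := rs_lower_tail eta n%:R p01' l01 (@lip_max_colored R I T C i0).
set Q := rs_Pr p (fun S => _ <= _ - _) in tail *.
have Q0 : 0 <= Q by exact: rs_Pr_ge0.
apply: le_trans (_ : Y ^+ r * (P * Q) <= _).
  by rewrite mulrA ler_peMl.
rewrite ler_wpM2l ?exprn_ge0//; apply: le_trans tail.
by rewrite ler_wpM2r.
Qed.

(** * Choice of the parameters, the uniformity being [r.+1] *)

Lemma scale_pow (R : realType) (r : nat) (d x : R) :
  (0 < r)%N -> 1 <= ln d ->
  x = ((r.+1%:R - 1) / r.+1%:R * (d / ln d)) `^ (1 / (r.+1%:R - 1)) ->
  0 < x /\ x ^+ r = r%:R / r.+1%:R * (d / ln d).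
Proof.
move=> r0 L1; have -> : r.+1%:R - 1 = r%:R :> R by rewrite -natr1 addrK.
have d0 : 0 < d.
  by rewrite ltNge; apply/negP => /ln0 h; move: L1; rewrite h; lra.
have y0 : 0 < r%:R / r.+1%:R * (d / ln d).
  by rewrite mulr_gt0 ?divr_gt0 ?ltr0n ?(lt_le_trans _ L1).
move=> ->; split; first exact: powR_gt0.
rewrite -powR_mulrn ?powR_ge0// -powRrM mul1r mulVf ?powRr1 ?(ltW y0)//.
by rewrite pnatr_eq0 -lt0n.
Qed.

(** Take logarithms in the formula for [x ^+ r]; the constant [ln (r / (r + 1))] lies between -1 and
    0. *)
Lemma scale_ln (R : realType) (r : nat) (d x : R) :
  (0 < r)%N -> 1 <= ln d -> 0 < x -> x ^+ r = r%:R / r.+1%:R * (d / ln d) ->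
  ln d - 1 - ln (ln d) <= r%:R * ln x <= ln d.
Proof.
move=> r0 L1 x0 xr.
have L0 : 0 < ln d by apply: lt_le_trans L1.
have d0 : 0 < d.
  by rewrite ltNge; apply/negP => /ln0 h; move: L1; rewrite h; lra.
have rR : 0 < r%:R :> R by rewrite ltr0n.
have c0 : 0 < r%:R / r.+1%:R :> R by rewrite divr_gt0 ?ltr0n.
have lx : r%:R * ln x = ln (r%:R / r.+1%:R) + (ln d - ln (ln d)).
  rewrite -ln_div ?posrE// -lnM ?posrE ?divr_gt0// -xr lnXn// mulr_natl.
  by [].
have c1 : ln (r%:R / r.+1%:R) <= 0 :> R.
  by rewrite ln_le0// ler_pdivrMr ?ltr0n// mul1r ler_nat.
have c2 : -1 <= ln (r%:R / r.+1%:R) :> R.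
  rewrite -[leLHS]expRK ler_ln ?posrE ?expR_gt0//.
  apply: le_trans (_ : 2^-1 <= _).
    rewrite expRN lef_pV2 ?posrE ?expR_gt0//.
    by have := expR_ge1Dx (1 : R); lra.
  rewrite ler_pdivlMr ?ltr0n// mulrC ler_pdivrMr// mulr_natr -natr1.
  by have : 1 <= r%:R :> R; [rewrite ler1n|lra].
have lL : 0 <= ln (ln d) by rewrite ln_ge0.
by rewrite lx; apply/andP; split; lra.
Qed.

(** [y] stands for the side of a box over [n]. Of the [D] factors of the second power, [r.+2] cancel
    the negative power of [y] and leave one factor [y]; the others are at most 1/2 each and beat the
    constants. *)
Lemma density_condition (R : realType) (r D : nat) (d l y : R) :
  (0 < r)%N -> (0 < D)%N -> 0 < d -> (r.+2 <= D)%N ->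
  12 * l <= 1 ->
  2 * expR 1 * d * (12 * l) ^+ r <= D%:R ->
  4 * expR 1 ^+ r.+1 * (expR 1 * d) ^+ r.+2 <= 2 ^+ (D - r.+2) ->
  0 < y <= 12 * l ->
  (expR 1 / y) ^+ r.+1 * (expR 1 * d / D%:R * y ^+ r) ^+ D <= y / 4.
Proof.
move=> r0 D0 d0 rD l1 G1 G2 /andP[y0 yl].
have DR : 0 < D%:R :> R by rewrite ltr0n.
have e0 := expR_gt0 (1 : R).
have y1 : y <= 1 by apply: le_trans l1.
have ed0 : 0 < expR 1 * d by rewrite mulr_gt0.
set a := expR 1 * d / D%:R.
have a0 : 0 <= a by rewrite divr_ge0 ?(ltW ed0).
have aD : a <= expR 1 * d.
  by rewrite ler_pdivrMr// ler_peMr ?(ltW ed0)// ler1n.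
have ay : a * y ^+ r <= 2^-1.
  apply: le_trans (_ : a * (12 * l) ^+ r <= _).
    by rewrite ler_wpM2l// lerXn2r ?nnegrE ?(ltW y0)// (le_trans (ltW y0)).
  by rewrite /a mulrAC ler_pdivrMr// ler_pdivlMl ?mulrA.
clearbody a; rewrite -{1}(subnK rD) exprD mulrCA.
have p1 : (a * y ^+ r) ^+ (D - r.+2) <= 2^-1 ^+ (D - r.+2).
  by rewrite lerXn2r// ?nnegrE ?invr_ge0// mulr_ge0// exprn_ge0// (ltW y0).
have p2 : (expR 1 / y) ^+ r.+1 * (a * y ^+ r) ^+ r.+2 <=
    expR 1 ^+ r.+1 * (expR 1 * d) ^+ r.+2 * y.
  rewrite !exprMn -exprM.
  have yy : y ^- r.+1 * y ^+ (r * r.+2) <= y.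
    rewrite mulrC ler_pdivrMr ?exprn_gt0// -exprS.
    by rewrite ler_wiXn2l ?(ltW y0)// leq_pmull.
  rewrite exprVn mulrACA; apply: ler_pM => //.
  - by rewrite mulr_ge0 ?exprn_ge0 ?(ltW e0).
  - by rewrite mulr_ge0 ?invr_ge0 ?exprn_ge0 ?(ltW y0).
  by rewrite ler_wpM2l ?exprn_ge0 ?(ltW e0)// -exprMn lerXn2r ?nnegrE ?(ltW ed0).
apply: le_trans (ler_pM _ _ p1 p2) _.
- by rewrite exprn_ge0 ?mulr_ge0 ?exprn_ge0 ?(ltW y0).
- apply: mulr_ge0; apply: exprn_ge0; first by rewrite divr_ge0 ?ltW.
  by rewrite mulr_ge0// exprn_ge0// (ltW y0).
rewrite exprVn; move: G2; move: (expR 1 ^+ r.+1) ((expR 1 * d) ^+ r.+2) => A B.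
have : 0 < 2 ^+ (D - r.+2) :> R by rewrite exprn_gt0.
move: (2 ^+ _) => t t0 G2.
have -> : t^-1 * (A * B * y) = A * B / t * y by ring.
rewrite [leRHS]mulrC ler_wpM2r ?(ltW y0)//.
by rewrite ler_pdivrMr//; lra.
Qed.

(** Up to powers of [ln q], [d] is at most of order [q^r] and [l^2] of order [q^-r], so the square
    of the left-hand side is at most of order [q^(2r - r^2)]. As [2r - r^2 <= 1], it stays below the
    square of [theta * q / 3]. *)
Lemma sparse_condition (R : realType) (r : nat) (c theta d q l D : R) :
  0 < theta -> 0 < c -> 1 <= q -> 0 <= l -> 0 <= d ->
  d <= 4 * r%:R * q ^+ r * ln q -> l ^+ 2 = c * ln q / q ^+ r ->
  64 * expR 1 ^+ 2 * r%:R ^+ 2 * (144 * c) ^+ r * 9 / theta ^+ 2 *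
    ln q ^+ r.+2 <= q ->
  theta * q / 3 <= D ->
  2 * expR 1 * d * (12 * l) ^+ r <= D.
Proof.
move=> th0 c0 q1 l0 d0 dq l2 Kq qD.
have q0 : 0 < q by apply: lt_le_trans q1.
have lq : 0 <= ln q by rewrite ln_ge0.
have e0 := expR_gt0 (1 : R).
have D0 : 0 <= D by apply: le_trans qD; rewrite !mulr_ge0 ?invr_ge0 ?ltW.
rewrite -(@ler_pXn2r _ 2)// ?nnegrE ?mulr_ge0 ?exprn_ge0 ?mulr_ge0 ?(ltW e0)//.
apply: le_trans (_ : (theta * q / 3) ^+ 2 <= _); last first.
  by rewrite lerXn2r ?nnegrE// !mulr_ge0 ?invr_ge0 ?ltW.
have -> : (2 * expR 1 * d * (12 * l) ^+ r) ^+ 2 =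
    (2 * expR 1 * d) ^+ 2 * (12 ^+ 2 * l ^+ 2) ^+ r.
  by rewrite exprMn -(exprMn _ 12) -!exprM (mulnC r).
rewrite l2; have -> : 12 ^+ 2 * (c * ln q / q ^+ r) = 144 * c * ln q / q ^+ r by ring.
rewrite expr_div_n (exprMn _ _ (ln q)) -exprM.
set Q := q ^+ (r * r); have Q0 : 0 < Q by rewrite exprn_gt0.
have h1 : (2 * expR 1 * d) ^+ 2 <=
    64 * expR 1 ^+ 2 * r%:R ^+ 2 * (q ^+ (2 * r) * ln q ^+ 2).
  have -> : 64 * expR 1 ^+ 2 * r%:R ^+ 2 * (q ^+ (2 * r) * ln q ^+ 2) =
      (2 * expR 1 * (4 * r%:R * q ^+ r * ln q)) ^+ 2.
    by rewrite (mulnC 2) exprM; ring.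
  rewrite lerXn2r ?nnegrE ?mulr_ge0 ?exprn_ge0 ?(ltW e0) ?(ltW q0)//.
  by rewrite ler_wpM2l// mulr_ge0 ?(ltW e0).
have h2 : q ^+ (2 * r) <= q * Q.
  have r2 : (2 * r <= (r * r).+1)%N.
    by clear; case: r => // r; rewrite mulSn mulnS; lia.
  by rewrite /Q -exprS; apply: (ler_weXn2l q1).
set P := (144 * c) ^+ r; have P0 : 0 <= P by rewrite exprn_ge0 ?mulr_ge0 ?ltW.
set E := 64 * expR 1 ^+ 2 * r%:R ^+ 2 in h1 Kq *.
have E0 : 0 <= E by rewrite !mulr_ge0 ?exprn_ge0 ?(ltW e0).
have h3 : (2 * expR 1 * d) ^+ 2 <= E * (q * Q * ln q ^+ 2).
  apply: le_trans h1 _; rewrite ler_wpM2l// ler_wpM2r ?exprn_ge0//.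
rewrite mulrA ler_pdivrMr//.
have PL0 : 0 <= P * ln q ^+ r by exact: mulr_ge0 P0 (exprn_ge0 _ lq).
apply: le_trans (ler_wpM2r PL0 h3) _.
have -> : E * (q * Q * ln q ^+ 2) * (P * ln q ^+ r) =
  (theta ^+ 2 / 9 * q * Q) * (E * P * 9 / theta ^+ 2 * ln q ^+ r.+2).
  have -> : ln q ^+ r.+2 = ln q ^+ r * ln q ^+ 2 by rewrite -exprD addn2.
  by move: (ln q ^+ r) => w; field; rewrite gt_eqF.
have -> : (theta * q / 3) ^+ 2 * Q = (theta ^+ 2 / 9 * q * Q) * q by field.
have : 0 <= theta ^+ 2 / 9 by rewrite mulr_ge0 ?exprn_ge0 ?invr_ge0 ?(ltW th0).
move=> t0; apply: ler_wpM2l Kq.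
by apply: mulr_ge0 (ltW Q0); apply: mulr_ge0 t0 (ltW q0).
Qed.

(** Compare logarithms, using [expR (1 / 2) <= 2] and [4 <= expR 2]. *)
Lemma power_condition (R : realType) (r N : nat) (d : R) :
  0 < d -> (2 + r.+1%:R + r.+2%:R * (1 + ln d)) * 2 <= N%:R ->
  4 * expR 1 ^+ r.+1 * (expR 1 * d) ^+ r.+2 <= 2 ^+ N.
Proof.
move=> d0 h.
have half : expR (1 / 2) <= 2 :> R.
  by apply: le_trans (expR_le_quad (lexx _)) _; lra.
have two : 2 <= expR 1 :> R by have := expR_ge1Dx (1 : R); lra.
apply: le_trans (_ : expR (1 / 2) ^+ N <= _); last first.
  by rewrite lerXn2r ?nnegrE ?expR_ge0.
apply: le_trans (_ : expR 2 * expR 1 ^+ r.+1 * (expR 1 * d) ^+ r.+2 <= _).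
  rewrite ler_wpM2r ?exprn_ge0 ?mulr_ge0 ?expR_ge0 ?(ltW d0)//.
  rewrite ler_wpM2r ?exprn_ge0 ?expR_ge0//.
  have -> : expR 2 = expR 1 ^+ 2 :> R by rewrite -expRM_natr mul1r.
  by rewrite expr2; nra.
have -> : expR 1 * d = expR (1 + ln d) by rewrite expRD lnK.
rewrite -!expRM_natr -!expRD ler_expR !mul1r [_ * r.+2%:R]mulrC.
by move: h; move: (r.+2%:R * _) => u h; lra.
Qed.

(** The choice of [q] makes [d / (r.+1 q^r)] at most [L / r / (1 + eps / 2)], while [ln q] is at
    least [(1 - eps / 12) L / r]; it remains that [1 + eps / 12 <= (1 - eps / 12)^2 (1 + eps /
    2)]. *)
Lemma equitable_condition (R : realType) (r : nat) (eps d x L q : R) :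
  (0 < r)%N -> 0 < eps < 1 -> 0 < L -> 0 < x ->
  d = x ^+ r * (r.+1%:R / r%:R) * L -> (1 + eps / 2) * x <= q ->
  (1 - eps / 12) * L <= r%:R * ln x ->
  (1 + eps / 12) * (d / (r.+1%:R * q ^+ r)) <= (1 - eps / 12) * ln q.
Proof.
move=> r0 /andP[ep0 ep1] L0 x0 dx xq lx.
have rR : 0 < r%:R :> R by rewrite ltr0n.
have rp : 0 < r.+1%:R :> R by rewrite ltr0n.
have ep2 : 1 <= 1 + eps / 2 by lra.
have ep12 : 0 <= 1 - eps / 12 by lra.
have xq' : x <= q by apply: le_trans xq; rewrite ler_peMl ?(ltW x0).
have qp : 0 < q by apply: lt_le_trans xq'.
have w0 : 0 < x ^+ r by rewrite exprn_gt0.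
have h1 : d / (r.+1%:R * q ^+ r) <= L / r%:R / (1 + eps / 2).
  have h : (1 + eps / 2) * x ^+ r <= q ^+ r.
    apply: le_trans (_ : ((1 + eps / 2) * x) ^+ r <= _); last first.
      rewrite lerXn2r ?nnegrE ?(ltW qp)// mulr_ge0 ?(ltW x0)//.
      exact: (le_trans ler01 ep2).
    rewrite exprMn ler_wpM2r ?(ltW w0)//.
    by rewrite -[leLHS]expr1 ler_weXn2l.
  have -> : L / r%:R / (1 + eps / 2) =
      d / (r.+1%:R * ((1 + eps / 2) * x ^+ r)).
    have e2 : 2 + eps != 0 by rewrite gt_eqF//; lra.
    rewrite dx; move: (x ^+ r) w0 => w w0; field.
    by rewrite e2 !gt_eqF.
  have d0 : 0 <= d by rewrite dx !mulr_ge0 ?invr_ge0 ?(ltW L0) ?(ltW w0).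
  rewrite ler_wpM2l// lef_pV2 ?posrE ?mulr_gt0 ?exprn_gt0//.
    by rewrite ler_wpM2l ?(ltW rp).
  exact: (lt_le_trans ltr01 ep2).
have h2 : (1 - eps / 12) * L / r%:R <= ln q.
  rewrite ler_pdivrMr// [leRHS]mulrC; apply: le_trans lx _.
  by rewrite ler_wpM2l ?(ltW rR)// ler_ln.
apply: le_trans (_ : (1 + eps / 12) * (L / r%:R / (1 + eps / 2)) <= _).
  by rewrite ler_wpM2l//; lra.
apply: le_trans (ler_wpM2l ep12 h2).
have Lr : 0 <= L / r%:R by rewrite divr_ge0 ?ltW.
rewrite mulrA ler_pdivrMr ?(lt_le_trans ltr01 ep2)//.
have -> : (1 - eps / 12) * ((1 - eps / 12) * L / r%:R) * (1 + eps / 2) =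
  (1 - eps / 12) * (1 - eps / 12) * (1 + eps / 2) * (L / r%:R) by ring.
rewrite ler_wpM2r//; clear -ep0 ep1; nra.
Qed.

(** [z] stands for [n / k]. As [(1 - eps) (1 + eps) <= 1], the term [d / z^r] is at least [1 + eps]
    times [(r.+1 / r) L], which itself bounds [r.+1 ln z]; the surplus, at least [eps L], covers the
    constants. *)
Lemma free_box_condition (R : realType) (r : nat) (eps d x L z : R) :
  (0 < r)%N -> 0 < eps < 1 -> 0 < L -> 0 < x ->
  d = x ^+ r * (r.+1%:R / r%:R) * L -> r%:R * ln x <= L ->
  r%:R + 2 <= eps * L -> 0 < z <= (1 - eps) * x ->
  r.+1%:R * (1 + ln z) - d / z ^+ r <= -1.
Proof.
move=> r0 /andP[ep0 ep1] L0 x0 dx lx hL /andP[z0 zx].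
have rR : 0 < r%:R :> R by rewrite ltr0n.
have rp : 0 < r.+1%:R :> R by rewrite ltr0n.
have r1R : r.+1%:R = r%:R + 1 :> R by rewrite natr1.
have rr1 : 1 <= r.+1%:R / r%:R :> R.
  by rewrite ler_pdivlMr// mul1r ler_nat.
have zx1 : z <= x by apply: le_trans zx _; rewrite ler_piMl ?(ltW x0)//; lra.
have lz : ln z <= ln x by rewrite ler_ln.
have xr0 : 0 <= x ^+ r by rewrite exprn_ge0 ?ltW.
have w0 : 0 <= (r.+1%:R / r%:R) * L.
  by rewrite mulr_ge0 ?(ltW L0)// (le_trans ler01).
have h1 : (1 + eps) * ((r.+1%:R / r%:R) * L) <= d / z ^+ r.
  rewrite ler_pdivlMr ?exprn_gt0// dx.
  have zr : z ^+ r <= (1 - eps) * x ^+ r.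
    apply: le_trans (_ : ((1 - eps) * x) ^+ r <= _).
      rewrite lerXn2r ?nnegrE ?(ltW z0)//; apply: le_trans zx; exact: ltW.
    rewrite exprMn ler_wpM2r//.
    by rewrite -[leRHS]expr1 ler_wiXn2l//; lra.
  have : (1 + eps) * z ^+ r <= x ^+ r.
    apply: le_trans (_ : (1 + eps) * ((1 - eps) * x ^+ r) <= _).
      by rewrite ler_wpM2l//; lra.
    have : 0 <= eps * eps * x ^+ r by rewrite !mulr_ge0 ?(ltW ep0).
    clear; lra.
  move/(ler_wpM2r w0); rewrite -mulrA mulrAC; congr (_ <= _); ring.
have h3 : r.+1%:R * ln z <= (r.+1%:R / r%:R) * L.
  rewrite mulrAC ler_pdivlMr// -mulrA ler_wpM2l ?(ltW rp)// mulrC.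
  by apply: le_trans lx; rewrite ler_wpM2l ?(ltW rR).
have h5 : eps * L <= eps * ((r.+1%:R / r%:R) * L).
  by rewrite ler_wpM2l ?(ltW ep0)// ler_peMl// ltW.
move: h1 h3 h5 hL; rewrite mulrDl mul1r mulrDr mulr1 r1R.
move: (_ / _ * L) (d / _) (_ * ln z) => u v w; clear; lra.
Qed.

(** [q] is about [(1 + eps / 2) x] and [D] about [theta x], where [theta] makes [r.+1 D] about
    [eps x / 8]; the rounding fits into the rest of [eps x]. *)
Lemma parameters (R : realType) (r : nat) (eps : R) :
  (0 < r)%N -> 0 < eps < 1 ->
  exists d0 : nat, forall d, d0%:R <= d -> forall x,
  x = ((r.+1%:R - 1) / r.+1%:R * (d / ln d)) `^ (1 / (r.+1%:R - 1)) ->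
  exists (q D : nat) (delta l : R),
  [/\ [/\ 0 < d, 0 < x, (0 < q)%N & (0 < D)%N],
      [/\ 0 < delta, 0 < l, l <= 48^-1 & l ^+ 2 = 2 * r.+1%:R * delta],
      (q + (r.+1 * D).+1)%:R <= (1 + eps) * x,
      forall (b : R) (s k : nat), (k <= s)%N -> 0 <= b ->
        b * s%:R ^+ r <= (1 + eps / 12) * (d / (r.+1%:R * q%:R ^+ r)) ->
        b * k%:R ^+ r.+1 <= delta * k%:R +
          k%:R * ln (q%:R * k%:R / s%:R) - k%:R + s%:R / q%:R &
      (forall y, 0 < y <= 12 * l ->
        (expR 1 / y) ^+ r.+1 * (expR 1 * d / D%:R * y ^+ r) ^+ D <= y / 4) /\
      (forall z, 0 < z <= (1 - eps) * x ->
        r.+1%:R * (1 + ln z) - d / z ^+ r <= -1)].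
Proof.
move=> r0 /andP[ep0 ep1].
pose A : R := expR (eps / 12)^-1.
pose c : R := 2 * r.+1%:R * A ^+ r.
pose theta : R := eps / (8 * r.+1%:R).
have rR : 1 <= r%:R :> R by rewrite ler1n.
have r1R : r.+1%:R = r%:R + 1 :> R by rewrite natr1.
have rp : 0 < r.+1%:R :> R by rewrite ltr0n.
have A0 : 0 < A by exact: expR_gt0.
have c0 : 0 < c by rewrite !mulr_gt0 ?exprn_gt0.
have th0 : 0 < theta by rewrite divr_gt0 ?mulr_gt0.
(* [Y0] brings [r ln x] close to [ln d], [Y1] gives [l <= 1/48], [Y3] serves [sparse_condition], and
   [Y4] makes [D] large compared with [ln d]. *)
have [Y0 [Y01 Y0P]] := ln_pow_le (24 / eps) 1.
have [Y1 [Y11 Y1P]] := ln_pow_le (c * 48 ^+ 2) 1.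
have [Y3 [Y31 Y3P]] := ln_pow_le
  (64 * expR 1 ^+ 2 * r%:R ^+ 2 * (144 * c) ^+ r * 9 / theta ^+ 2) r.+2.
pose K4 : R := 2 * (2 * r%:R + 5) + (r%:R + 2) + 4 * r%:R * (r%:R + 2).
have [Y4 [Y41 Y4P]] := ln_pow_le (3 / theta * K4) 1.
(* The fourth summand absorbs the rounding of [q] and [D]; the last one gives [ln q >= 1]. *)
pose X0 : R := Y1 + Y3 + Y4 + 8 * (r%:R + 3) / (3 * eps) + expR 1.
have e0 := expR_gt0 (1 : R).
have t0 : 0 < 8 * (r%:R + 3) / (3 * eps) by rewrite divr_gt0 ?mulr_gt0 //; lra.
have X0gt : 1 <= X0 by rewrite /X0; lra.
(* The third summand serves the edge-free boxes; the last one forces [x >= X0], as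
   [ln d <= 2 r ln x]. *)
pose L1 : R := Y0 + 24 / eps + (r%:R + 2) / eps + 2 * r%:R * ln X0.
have u1 : 0 < 24 / eps by rewrite divr_gt0.
have u2 : 0 < (r%:R + 2) / eps by rewrite divr_gt0//; lra.
have u3 : 0 <= 2 * r%:R * ln X0 by rewrite !mulr_ge0 ?ln_ge0.
exists (Num.truncn (expR L1)).+1 => d dd0 x xE.
have dL1 : expR L1 < d by apply: lt_le_trans dd0; rewrite truncnS_gt.
have d0 : 0 < d by apply: lt_trans dL1; exact: expR_gt0.
set L := ln d in xE *.
have LL1 : L1 <= L by rewrite -[L1]expRK ler_ln ?posrE ?expR_gt0// ltW.
have L_1 : 1 <= L by apply: le_trans LL1; rewrite /L1; clear -Y01 u1 u2 u3; lra.
have L0 : 0 < L by apply: lt_le_trans L_1.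
have [x0 xr] := scale_pow r0 L_1 xE.
have /andP[lx1 lx2] := scale_ln r0 L_1 x0 xr.
rewrite -/L in lx1 lx2 xr.
have lx3 : (1 - eps / 12) * L <= r%:R * ln x.
  apply: le_trans lx1.
  have h1 : 24 / eps * ln L <= L.
    have LY : Y0 <= L.
      by apply: le_trans LL1; rewrite /L1; clear -u1 u2 u3; lra.
    by have := Y0P L LY; rewrite expr1.
  have h2 : 24 / eps <= L.
    by apply: le_trans LL1; rewrite /L1; clear -Y01 u2 u3; lra.
  rewrite mulrAC ler_pdivrMr// in h1; rewrite ler_pdivrMr// in h2.
  by clear -h1 h2; lra.
have lx4 : L <= 2 * r%:R * ln x.
  have : (1 - eps / 12) * L >= 2^-1 * L by rewrite ler_wpM2r ?(ltW L0)//; clear -ep0 ep1; lra.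
  by rewrite -mulrA; clear -lx3; lra.
have xX0 : X0 <= x.
  rewrite -ler_ln ?posrE ?(lt_le_trans _ X0gt)//.
  have h : 2 * r%:R * ln X0 <= 2 * r%:R * ln x.
    apply: le_trans lx4; apply: le_trans LL1; rewrite /L1.
    by clear -Y01 u1 u2; lra.
  by move: h; rewrite ler_pM2l// mulr_gt0// (lt_le_trans ltr01 rR).
have x1 : 1 <= x by apply: le_trans xX0.
pose q := (Num.truncn ((1 + eps / 2) * x)).+1.
pose D := (Num.truncn (theta * x)).+1.
have yq0 : 0 <= (1 + eps / 2) * x.
  by rewrite mulr_ge0 ?(ltW x0)//; clear -ep0; lra.
have yD0 : 0 <= theta * x by rewrite mulr_ge0 ?ltW.
have q_lo : (1 + eps / 2) * x <= q%:R by rewrite ltW// truncnS_gt.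
have q_hi : q%:R <= (1 + eps / 2) * x + 1.
  by rewrite /q -natr1 lerD2r truncn_le.
have D_lo : theta * x <= D%:R by rewrite ltW// truncnS_gt.
have D_hi : D%:R <= theta * x + 1 by rewrite /D -natr1 lerD2r truncn_le.
have epx : 0 <= eps * x by rewrite mulr_ge0 ?ltW.
have epx1 : eps * x <= x by rewrite ler_piMl ?ltW.
have xq : x <= q%:R by apply: le_trans q_lo; clear -epx; lra.
have q3x : q%:R <= 3 * x by clear -q_hi epx1 x1; lra.
have qD : theta * q%:R / 3 <= D%:R.
  apply: le_trans D_lo; rewrite -mulrA ler_wpM2l ?(ltW th0)//; clear -q3x; lra.
clearbody q D.
have qp : 0 < q%:R :> R by apply: lt_le_trans xq.
have q1 : 1 <= q%:R :> R by apply: le_trans xq.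
have lqx : ln x <= ln q%:R by rewrite ler_ln ?posrE.
have lq1 : 1 <= ln q%:R :> R.
  rewrite -[leLHS]expRK ler_ln ?posrE//; apply: le_trans xq.
  by apply: le_trans xX0; rewrite /X0; clear -Y11 Y31 Y41 t0; lra.
have Lq : L <= 2 * r%:R * ln q%:R.
  by apply: le_trans lx4 _; rewrite ler_wpM2l//; clear -rR; lra.
have qY1 : Y1 <= q%:R.
  apply: le_trans xq; apply: le_trans xX0; rewrite /X0.
  by clear -Y31 Y41 t0 e0; lra.
have qY3 : Y3 <= q%:R.
  apply: le_trans xq; apply: le_trans xX0; rewrite /X0.
  by clear -Y11 Y41 t0 e0; lra.
have qY4 : Y4 <= q%:R.
  apply: le_trans xq; apply: le_trans xX0; rewrite /X0.
  by clear -Y11 Y31 t0 e0; lra.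
pose delta : R := ln q%:R * (A / q%:R) ^+ r.
have delta0 : 0 < delta.
  by rewrite mulr_gt0 ?(lt_le_trans _ lq1)// exprn_gt0// divr_gt0.
(* With [l / 2] and [eta = 6 l n] the tail bound is [exp (- 2 l^2 n)], whereas dividing by the
   probability of full coverage costs at most [exp (2 (r + 1) delta n) = exp (l^2 n)] for large
   [n]. *)
pose l := Num.sqrt (2 * r.+1%:R * delta).
have l2 : l ^+ 2 = 2 * r.+1%:R * delta by rewrite sqr_sqrtr// mulr_ge0 ?(ltW delta0).
have l0 : 0 < l by rewrite sqrtr_gt0 mulr_gt0 ?delta0// mulr_gt0.
have l2c : l ^+ 2 = c * ln q%:R / q%:R ^+ r.
  by rewrite l2 /delta /c expr_div_n; move: (q%:R ^+ r)^-1 (A ^+ r) => a b; ring.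
have l48 : l <= 48^-1.
  rewrite -(@ler_pXn2r _ 2)// ?nnegrE ?(ltW l0)// l2c.
  rewrite ler_pdivrMr ?exprn_gt0// exprVn ler_pdivlMl ?exprn_gt0//.
  apply: le_trans (_ : q%:R <= _).
    by apply: le_trans (Y1P _ qY1); rewrite expr1 mulrA (mulrC c).
  by rewrite -[leLHS]expr1 ler_weXn2l.
have q0N : (0 < q)%N by rewrite -(ltr0n R).
have D0R : 0 < D%:R :> R.
  by apply: lt_le_trans D_lo; rewrite mulr_gt0.
have D0N : (0 < D)%N by rewrite -(ltr0n R).
have dx : d = x ^+ r * (r.+1%:R / r%:R) * L.
  rewrite xr; have r_0 : r%:R != 0 :> R by rewrite pnatr_eq0 -lt0n.
  by field; rewrite r_0 !gt_eqF.
exists q, D, delta, l; split.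
- by [].
- by [].
- rewrite natrD -natr1 natrM.
  have h1 : r.+1%:R * D%:R <= eps * x / 8 + r.+1%:R.
    apply: le_trans (ler_wpM2l (ltW rp) D_hi) _.
    by rewrite mulrDr mulr1 lerD2r /theta le_eqVlt; apply/orP; left; apply/eqP;
      field; rewrite gt_eqF.
  have h2 : 8 * (r%:R + 3) <= 3 * (eps * x).
    have : 8 * (r%:R + 3) / (3 * eps) <= x.
      by apply: le_trans xX0; rewrite /X0; clear -Y11 Y31 Y41 e0; lra.
    by rewrite ler_pdivrMr ?mulr_gt0//; clear; lra.
  by clear -h1 h2 q_hi r1R; lra.
- move=> b s k ks b0 hb.
  apply: (@overlap_pointwise R r.+1 q s k b (eps / 12)) => //.
    by clear -ep0 ep1; apply/andP; split; lra.
  apply: le_trans hb _ => /=.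
  by apply: (@equitable_condition R r eps d x L) => //; rewrite ep0.
- split; last first.
    move=> z; apply: (@free_box_condition R r eps d x L) => //.
      by rewrite ep0.
    have : (r%:R + 2) / eps <= L.
      by apply: le_trans LL1; rewrite /L1; clear -u1 u3 Y01; lra.
    by rewrite ler_pdivrMr// mulrC.
  have K4q : K4 * ln q%:R <= theta * q%:R / 3.
    rewrite ler_pdivlMr//; have := ler_wpM2l (ltW th0) (Y4P _ qY4).
    rewrite expr1; congr (_ <= _).
    by clear -th0; move: (ln q%:R) K4 => a b; field; rewrite gt_eqF.
  have K40 : r%:R + 2 <= K4 by rewrite /K4; clear -rR; nra.
  move=> y; apply: density_condition => //.
  + rewrite -(ler_nat R) -natr1 -natr1; apply: le_trans qD.
    apply: le_trans K4q; apply: le_trans (_ : K4 <= _).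
      by clear -K40; lra.
    by rewrite ler_peMr//; clear -K40 rR; lra.
  + by clear -l48; lra.
  + apply: (@sparse_condition R r c theta d q%:R l D%:R) => //.
    * exact: ltW.
    * exact: ltW.
    * have -> : 4 * r%:R * q%:R ^+ r * ln q%:R =
          q%:R ^+ r * 2 * (2 * r%:R * ln q%:R) :> R by ring.
      rewrite dx; apply: ler_pM (ltW L0) _ Lq.
        by rewrite mulr_ge0 ?exprn_ge0 ?(ltW x0)// divr_ge0.
      apply: ler_pM; rewrite ?exprn_ge0 ?(ltW x0) ?divr_ge0//.
        by rewrite lerXn2r ?nnegrE ?(ltW x0) ?(ltW qp).
      by rewrite ler_pdivrMr ?(lt_le_trans ltr01 rR)//; clear -rR r1R; lra.
    * exact: Y3P.
  + apply: power_condition => //.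
    rewrite natrB; last first.
      rewrite -(ler_nat R) -natr1 -natr1; apply: le_trans qD.
      apply: le_trans K4q; apply: le_trans (_ : K4 <= _).
        by clear -K40; lra.
      by rewrite ler_peMr//; clear -K40 rR; lra.
    rewrite lerBrDr; apply: le_trans qD; apply: le_trans K4q.
    have -> : r.+2%:R = r%:R + 2 :> R by rewrite -natr1 r1R -addrA.
    rewrite r1R.
    have h1 : (r%:R + 2) * L <= (r%:R + 2) * (2 * r%:R * ln (q%:R : R)).
      by rewrite ler_wpM2l// addr_ge0.
    have h2 : 2 * (2 * r%:R + 5) + (r%:R + 2) <=
        (2 * (2 * r%:R + 5) + (r%:R + 2)) * ln (q%:R : R).
      by rewrite ler_peMr//; clear -rR; lra.
    by rewrite /K4 -/L; clear -h1 h2; lra.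
Qed.

(** * The bad events for large n *)

Lemma pow_le_expR (R : realType) (kappa K : R) (m : nat) : 0 < kappa ->
  exists n0 : nat, forall n, (n0 <= n)%N -> K * n.+1%:R ^+ m <= expR (kappa * n%:R).
Proof.
move=> k0; pose M := `|K| * 2 ^+ m * (m.+1)`!%:R / kappa ^+ m.+1.
have f0 : 0 < (m.+1)`!%:R :> R by rewrite ltr0n fact_gt0.
exists (Num.truncn M).+1 => n nM.
have nMR : M <= n%:R.
  by apply: le_trans (_ : (Num.truncn M).+1%:R <= _);
    [rewrite ltW// truncnS_gt|rewrite ler_nat].
have n1 : (0 < n)%N by apply: leq_trans nM.
have kn : 0 <= kappa * n%:R by rewrite mulr_ge0 ?(ltW k0).
have h : (kappa * n%:R) ^+ m.+1 / m.+1`!%:R <= expR (kappa * n%:R).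
  by apply: le_trans (expR_ge1Dxn m kn); rewrite lerDr.
apply: le_trans h.
apply: le_trans (_ : `|K| * (2 * n%:R) ^+ m <= _).
  apply: le_trans (ler_wpM2r _ (ler_norm K)) _; first exact: exprn_ge0.
  rewrite ler_wpM2l// lerXn2r ?nnegrE ?mulr_ge0// -natrM ler_nat; lia.
rewrite ler_pdivlMr// !exprMn exprS [n%:R ^+ m.+1]exprS.
move: nMR; rewrite /M ler_pdivrMr ?exprn_gt0// exprS => h.
have := ler_wpM2r (exprn_ge0 m (ler0n R n)) h.
by congr (_ <= _); ring.
Qed.

(** The class size [s] is at most [n / q + 1], which costs a factor [exp (r q / n)], and
    [- ln (1 - p)] is at most [p exp (2 d / n)]; together these factors are at most
    [1 + eps / 12]. *)
Lemma edge_prob_bound (R : realType) (r q n s : nat) (d eps p : R) :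
  (0 < q)%N -> (0 < n)%N -> 0 < eps < 1 -> 0 <= d -> p = d / n%:R ^+ r ->
  p <= d / n%:R -> (r%:R * q%:R + 2 * d) / n%:R <= eps / 24 ->
  (q * s.-1 <= n)%N ->
  - ln (1 - p) / r.+1%:R * s%:R ^+ r <=
    (1 + eps / 12) * (d / (r.+1%:R * q%:R ^+ r)).
Proof.
move=> q0 n0 /andP[ep0 ep1] d0 pE pd hu qs.
have nR : 0 < n%:R :> R by rewrite ltr0n.
have qR : 0 < q%:R :> R by rewrite ltr0n.
have rp : 0 < r.+1%:R :> R by rewrite ltr0n.
set u := _ / n%:R in hu.
have uE : u = r%:R * (q%:R / n%:R) + 2 * (d / n%:R) by rewrite /u; ring.
have dn0 : 0 <= d / n%:R by rewrite divr_ge0 ?(ltW nR).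
have qn0 : 0 <= r%:R * (q%:R / n%:R) :> R by rewrite mulr_ge0// divr_ge0.
have p0 : 0 <= p by rewrite pE divr_ge0 ?exprn_ge0.
have p2 : p <= 2^-1 by clear -hu uE qn0 dn0 pd ep1; lra.
have p1 : 0 < 1 - p by clear -p2; lra.
have hln : - ln (1 - p) <= p / (1 - p).
  have h : -1 < p / (1 - p).
    by apply: (@lt_le_trans _ _ 0); rewrite ?ltrN10// divr_ge0// ltW.
  have := le_ln1Dx h.
  have -> : 1 + p / (1 - p) = (1 - p)^-1 by field; rewrite gt_eqF.
  by rewrite lnV ?posrE.
have s1 : s%:R <= n%:R / q%:R * (1 + q%:R / n%:R) :> R.
  have -> : n%:R / q%:R * (1 + q%:R / n%:R) = n%:R / q%:R + 1 :> R.
    by field; rewrite !gt_eqF.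
  rewrite -lerBlDr ler_pdivlMr//.
  case: (s) qs => [|s'] /= qs; first by rewrite sub0r mulN1r (@le_trans _ _ 0)// oppr_le0 ltW.
  by rewrite -natr1 addrK -natrM ler_nat mulnC.
have s2 : s%:R ^+ r <= n%:R ^+ r / q%:R ^+ r * expR (r%:R * (q%:R / n%:R)) :> R.
  apply: le_trans (_ : (n%:R / q%:R * (1 + q%:R / n%:R)) ^+ r <= _).
    rewrite lerXn2r ?nnegrE// mulr_ge0 ?divr_ge0 ?addr_ge0 ?divr_ge0 ?ltW//.
  rewrite exprMn expr_div_n ler_wpM2l ?divr_ge0 ?exprn_ge0 ?(ltW nR)//.
  rewrite [r%:R * _]mulrC expRM_natr lerXn2r ?nnegrE ?expR_ge0 ?expR_ge1Dx//.

have s3 : (1 - p)^-1 <= expR (2 * (d / n%:R)).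
  apply: le_trans (_ : 1 + 2 * p <= _); last first.
    by apply: le_trans (expR_ge1Dx _); clear -pd; lra.
  rewrite -[leLHS]mul1r ler_pdivrMr//; clear -p0 p2; nra.
have eu : expR u <= 1 + eps / 12.
  have u12 : u <= 1 / 2 by clear -hu ep1; lra.
  apply: le_trans (expR_le_quad u12) _.
  have u0 : 0 <= u by rewrite uE; clear -qn0 dn0; lra.
  by clear -u0 u12 hu; nra.
apply: le_trans (_ : p / (1 - p) / r.+1%:R *
    (n%:R ^+ r / q%:R ^+ r * expR (r%:R * (q%:R / n%:R))) <= _).
  apply: ler_pM => //; rewrite ?exprn_ge0//.
    by rewrite divr_ge0// oppr_ge0 ln_le0// gerBl.
  by rewrite ler_wpM2r ?invr_ge0.
have -> : p / (1 - p) / r.+1%:R *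
    (n%:R ^+ r / q%:R ^+ r * expR (r%:R * (q%:R / n%:R))) =
    ((1 - p)^-1 * expR (r%:R * (q%:R / n%:R))) * (d / (r.+1%:R * q%:R ^+ r)).
  rewrite {1}pE; have := exprn_gt0 r nR; have := exprn_gt0 r qR.
  move: (n%:R ^+ r) (q%:R ^+ r) (expR _) => a b e b0 a0.
  by field; rewrite !gt_eqF.
rewrite ler_wpM2r ?divr_ge0 ?mulr_ge0 ?exprn_ge0//.
apply: le_trans eu; rewrite uE expRD mulrC ler_wpM2l ?expR_ge0//.
Qed.

Definition bad_event (R : realType) (I T C : finType) (k m s D : nat) (eta : R)
    (S : {set {ffun I -> T}}) : bool :=
  [|| free_box k S, (max_colored C S)%:R <= #|T|%:R - eta,
      dense_box D s S | high_degree m S].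

(** The deterministic part: the absence of edge-free boxes gives the lower bound, and the other
    three conditions make [extend_coloring] applicable. *)
Lemma not_bad_event (R : realType) (r n q k m s D : nat) (eta L U : R)
    (S : {set {ffun 'I_r -> 'I_n}}) :
  (2 <= r)%N -> (0 < n)%N -> (0 < q)%N -> (0 < k)%N ->
  (2 * m < s)%N -> (s <= n)%N -> eta <= s%:R ->
  (forall q', (n <= q' * k.-1)%N -> L <= q'%:R) ->
  (q + (r * D).+1)%:R <= U ->
  ~~ bad_event 'I_q k m s D eta S ->
  (L%:E <= balanced_chromatic_number R (@part r n) [set edge_of f | f in S])%E &&
  (balanced_chromatic_number R (@part r n) [set edge_of f | f in S] <= U%:E)%E.
Proof.
move=> r2 n0 q0 k0 ms sn es hL hU.
rewrite !negb_or => /and4P[nfree ncol ndense ndeg].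
apply: balanced_chromatic_number_bounds; last first.
  by move=> q' /(balanced_colorable_lower (ltnW r2) k0 nfree); exact: hL.
pose i0 : 'I_r := Ordinal (ltnW r2); pose i1 : 'I_r := Ordinal r2.
have i01 : i0 != i1 by [].
have deg i v : (#|[set f in S | f i == v]| <= m)%N.
  have := ndeg; rewrite negb_exists => /forallP/(_ (i, v)); rewrite -ltnNge => h.
  by apply: leq_trans (ltnW h); rewrite /= subset_leq_card//;
    apply/fintype.subsetP => f; rewrite !inE.
have dens (W : 'I_r -> {set 'I_n}) w : (w <= s)%N -> (forall i, #|W i| = w) ->
    (#|S :&: box W| <= D * w)%N.
  move=> ws cW; have [w0|w0] := posnP w.
    rewrite w0 muln0 leqn0 cards_eq0; apply/eqP/setP => f; rewrite !inE.
    apply/negP => /andP[_ /forallP/(_ i0)].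
    by have /eqP := cW i0; rewrite w0 cards_eq0 => /eqP ->; rewrite inE.
  have := ndense; rewrite negb_exists => /forallP/(_ (Ordinal (ws : w < s.+1)%N)).
  rewrite /= w0 /= negb_exists => /forallP/(_ [ffun i => W i]).
  have -> : [ffun i => W i] \in
      box (fun _ : 'I_r => [set A : {set 'I_n} | #|A| == w]).
    by rewrite inE; apply/forallP => i; rewrite inE ffunE cW.
  rewrite /= -ltnNge => /ltnW; congr (_ <= _)%N; apply: eq_card => f.
  by rewrite !inE; congr (_ && _); apply: eq_forallb => i; rewrite ffunE.
have col : (#|'I_n| <= max_colored 'I_q S + s)%N.
  rewrite -(ler_nat R) natrD; move: ncol; rewrite -ltNge => h.
  by move: h es; clear; lra.
have sn' : (s <= #|'I_n|)%N by rewrite card_ord.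
have [pi [c good]] := extend_coloring (Ordinal q0) i01 deg dens ms sn' col.
exists (q + (r * D).+1)%N => //.
by have := balanced_colorable_good good; rewrite card_sum !card_ord.
Qed.

Lemma Pr_bad_event (R : realType) (I T C : finType) (p eta : R) (k m s D : nat)
    (e1 e2 e3 e4 : R) : 0 <= p <= 1 ->
  rs_Pr p (free_box (I := I) (T := T) k) <= e1 ->
  rs_Pr p (fun S : {set {ffun I -> T}} =>
      (max_colored C S)%:R <= #|T|%:R - eta) <= e2 ->
  rs_Pr p (dense_box (I := I) (T := T) D s) <= e3 ->
  rs_Pr p (high_degree (I := I) (T := T) m) <= e4 ->
  rs_Pr p (bad_event (I := I) (T := T) C k m s D eta) <= e1 + (e2 + (e3 + e4)).
Proof.
move=> p01 h1 h2 h3 h4.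
apply: le_trans (rs_Pr_or _ _ p01) _; apply: lerD => //.
apply: le_trans (rs_Pr_or _ _ p01) _; apply: lerD => //.
by apply: le_trans (rs_Pr_or _ _ p01) _; apply: lerD.
Qed.

Lemma archi_le (R : realType) (K : R) :
  exists n0 : nat, forall n, (n0 <= n)%N -> K <= n%:R.
Proof.
exists (Num.truncn K).+1 => n nK; apply: ltW.
by apply: lt_le_trans (truncnS_gt K) _; rewrite ler_nat.
Qed.

Lemma Pr_bad_event_le (R : realType) (r q D : nat) (d eps x delta l : R) :
  (0 < r)%N -> 0 < eps < 1 -> 0 < d -> 0 < x -> (0 < q)%N -> (0 < D)%N ->
  0 < delta -> 0 < l -> l <= 48^-1 -> l ^+ 2 = 2 * r.+1%:R * delta ->
  (forall (b : R) (s k : nat), (k <= s)%N -> 0 <= b ->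
        b * s%:R ^+ r <= (1 + eps / 12) * (d / (r.+1%:R * q%:R ^+ r)) ->
        b * k%:R ^+ r.+1 <= delta * k%:R +
          k%:R * ln (q%:R * k%:R / s%:R) - k%:R + s%:R / q%:R) ->
  (forall y, 0 < y <= 12 * l ->
        (expR 1 / y) ^+ r.+1 * (expR 1 * d / D%:R * y ^+ r) ^+ D <= y / 4) ->
  (forall z, 0 < z <= (1 - eps) * x ->
        r.+1%:R * (1 + ln z) - d / z ^+ r <= -1) ->
  exists n0 : nat, forall n, (n0 <= n)%N ->
  (0 < n)%N /\ exists k m s : nat, [/\ (0 < k)%N, (2 * m < s <= n)%N,
    6 * l * n%:R <= s%:R,
    (forall q', (n <= q' * k.-1)%N -> (1 - eps) * x <= q'%:R) &
    0 <= d / n%:R ^+ r <= 1 /\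
    rs_Pr (d / n%:R ^+ r)
      (bad_event (I := 'I_r.+1) (T := 'I_n) 'I_q k m s D (6 * l * n%:R)) <=
      4 / n%:R].
Proof.
move=> r0 /andP[ep0 ep1] d0 x0 q0 D0 de0 l0 l48 l2 Hov Hden Hfree.
(* Below, [n1] serves [edge_prob_bound] and [p <= 1/2], [n2] the rounding of [m] and [s], [n3] and
   [n7] the degrees, [n4] and [n5] the coverage, [n6] the edge-free boxes. *)
have ex0 : 0 < (1 - eps) * x by rewrite mulr_gt0// subr_gt0.
have [n1 N1] := archi_le (24 * (r%:R * q%:R + 2 * d) / eps).
have [n2 N2] := archi_le (2 / l).
have [n3 N3] := archi_le (2 * expR 1 * d / (3 / 2 * l)).
have rde : 0 < r.+1%:R * delta by rewrite mulr_gt0.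
have [n4 N4] := pow_le_expR 1 ((q ^ 2 + q) * r.+1) rde.
have ll : 0 < l ^+ 2 by rewrite exprn_gt0.
have [n5 N5] := pow_le_expR 1 1 ll.
have ix : 0 < ((1 - eps) * x)^-1 by rewrite invr_gt0.
have [n6 N6] := pow_le_expR 1 1 ix.
have l34 : 0 < 3 / 4 * l by rewrite mulr_gt0.
have [n7 N7] := pow_le_expR r.+1%:R 2 l34.
exists (n1 + n2 + n3 + n4 + n5 + n6 + n7 + 2)%N => n nn.
have [h1 h2 h3 h4 [h5 h6 h7 n1']] : [/\ n1 <= n, n2 <= n, n3 <= n, n4 <= n &
    [/\ n5 <= n, n6 <= n, n7 <= n & 2 <= n]]%N.
  by clear -nn; do 2?split; lia.
have {}N1 := N1 n h1; have {}N2 := N2 n h2; have {}N3 := N3 n h3.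
have {}N4 := N4 n h4; have {}N5 := N5 n h5; have {}N6 := N6 n h6.
have {}N7 := N7 n h7.
have n0 : (0 < n)%N by exact: leq_trans n1'.
have nR : 0 < n%:R :> R by rewrite ltr0n.
have n2R : 2 <= n%:R :> R by rewrite ler_nat.
set p := d / n%:R ^+ r.
have pd : p <= d / n%:R.
  rewrite ler_wpM2l ?(ltW d0)// lef_pV2 ?posrE ?exprn_gt0//.
  by rewrite -[leLHS]expr1 ler_weXn2l// ler1n.
have hu : (r%:R * q%:R + 2 * d) / n%:R <= eps / 24.
  rewrite ler_pdivrMr//; move: N1; rewrite ler_pdivrMr//; clear; lra.
have p0 : 0 <= p by rewrite divr_ge0 ?exprn_ge0 ?ltW.
have p2 : p <= 2^-1.
  have : 0 <= r%:R * q%:R / n%:R :> R by rewrite divr_ge0// mulr_ge0.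
  by move: hu; rewrite mulrDl -(mulrA 2); clear -pd ep1; lra.
have p01 : 0 <= p <= 1 by rewrite p0; clear -p2; lra.
have p01' : 0 <= p < 1 by rewrite p0; clear -p2; lra.
have ln2 : 2 <= l * n%:R.
  by move: N2; rewrite ler_pdivrMr// mulrC.
(* Rounding up gives [n / k <= (1 - eps) x] for the edge-free boxes, while [k.-1] is still small
   enough that [n <= q' * k.-1] yields [(1 - eps) x <= q']. As [s] is about [4 m], it exceeds
   [2 m]. *)
pose k := (Num.truncn (n%:R / ((1 - eps) * x))).+1.
pose m := (Num.truncn (3 / 2 * l * n%:R)).+1.
pose s := (Num.truncn (6 * l * n%:R)).+1.
have k_lo : n%:R / ((1 - eps) * x) <= k%:R by rewrite ltW// truncnS_gt.
have k_hi : k.-1%:R <= n%:R / ((1 - eps) * x).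
  by rewrite /k /= truncn_le divr_ge0 ?ltW.
have m_lo : 3 / 2 * l * n%:R <= m%:R by rewrite ltW// truncnS_gt.
have ln0 : 0 <= l * n%:R by rewrite mulr_ge0 ?ltW.
have m_hi : m%:R <= 3 / 2 * l * n%:R + 1.
  by rewrite /m -natr1 lerD2r truncn_le; clear -ln0; lra.
have s_lo : 6 * l * n%:R <= s%:R by rewrite ltW// truncnS_gt.
have s_hi : s%:R <= 6 * l * n%:R + 1.
  by rewrite /s -natr1 lerD2r truncn_le; clear -ln0; lra.
have k0 : (0 < k)%N by [].
have m0 : (0 < m)%N by [].
clearbody k m s.
have l48n : l * n%:R <= n%:R / 48 by rewrite mulrC ler_wpM2l ?(ltW nR).
have ms : (2 * m < s)%N.
  by rewrite -(ltr_nat R) natrM; clear -m_hi s_lo ln2; lra.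
have sn : (s <= n)%N.
  by rewrite -(ler_nat R); clear -s_hi l48n n2R; lra.
split=> //; exists k, m, s; split=> //; first by rewrite ms.
  move=> q' nq.
  have h : n%:R <= q'%:R * (n%:R / ((1 - eps) * x)) :> R.
    apply: le_trans (_ : (q' * k.-1)%:R <= _); first by rewrite ler_nat.
    by rewrite natrM ler_wpM2l.
  by move: h; rewrite mulrA ler_pdivlMr// [n%:R * _]mulrC ler_pM2r.
split=> //.
have inv_bound (a : R) : 1 * n.+1%:R ^+ 1 <= expR a -> expR (- a) <= n%:R^-1.
  rewrite mul1r expr1 expRN => h.
  rewrite lef_pV2 ?posrE ?expR_gt0//; apply: le_trans h; by rewrite ler_nat.
have -> : 4 / n%:R = n%:R^-1 + (n%:R^-1 + (n%:R^-1 + n%:R^-1)) :> R by ring.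
apply: Pr_bad_event => //.
- apply: le_trans (Pr_free_box_exp p01 _ _ k0 _) _; rewrite ?card_ord//.
    have kR : 0 < k%:R :> R by rewrite ltr0n.
    have := Hfree (n%:R / k%:R).
    rewrite divr_gt0//= ler_pdivrMr// mulrC -ler_pdivrMr// => /(_ k_lo).
    congr (_ - _ <= _); rewrite /p /= expr_div_n.
    have := exprn_gt0 r nR; have := exprn_gt0 r kR.
    by move: (n%:R ^+ r) (k%:R ^+ r) => a b b0 a0; field; rewrite !gt_eqF.
  have h := inv_bound _ N6; apply: le_trans h.
  by rewrite ler_expR lerN2 mulrC.
- apply: le_trans (@Pr_few_colored R 'I_r.+1 'I_n 'I_q p delta (l / 2) _ _ _ p01' _ _) _;
    rewrite ?card_ord//.
  + by clear -l0 l48; apply/andP; split; lra.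
  + move=> s' k' ks' qs; apply: Hov => //.
      by rewrite divr_ge0// oppr_ge0 ln_le0// gerBl.
    by apply: edge_prob_bound qs => //; [rewrite ep0|exact: ltW].
  rewrite exprMn -exprM.
  have hN := N4; rewrite mul1r in hN.
  apply: le_trans (_ : expR (r.+1%:R * delta * n%:R) *
    expR (delta * n%:R) ^+ r.+1 *
    expR (4 * (l / 2) ^+ 2 * n%:R - l / 2 * (6 * l * n%:R)) <= _).
    by rewrite !ler_wpM2r ?exprn_ge0 ?expR_ge0.
  apply: le_trans (inv_bound _ N5).
  rewrite -expRM_natr -!expRD ler_expR.
  have -> : r.+1%:R * delta * n%:R + delta * n%:R * r.+1%:R +
    (4 * (l / 2) ^+ 2 * n%:R - l / 2 * (6 * l * n%:R)) =
    (2 * r.+1%:R * delta) * n%:R - 2 * l ^+ 2 * n%:R by field.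
  by rewrite -l2 le_eqVlt; apply/orP; left; apply/eqP; ring.
- have := @Pr_dense_box R 'I_r.+1 'I_n p D s p01 D0; rewrite !card_ord; apply=> //.
  move=> w /andP[w0 ws].
  have wR : 0 < w%:R :> R by rewrite ltr0n.
  have DR : 0 < D%:R :> R by rewrite ltr0n.
  have := Hden (w%:R / n%:R); rewrite divr_gt0//= ler_pdivrMr//.
  have wsl : w%:R <= 12 * l * n%:R.
    apply: le_trans (_ : s%:R <= _); first by rewrite ler_nat.
    by clear -s_hi ln2; lra.
  move=> /(_ wsl); congr (_ * _ <= _).
    by congr (_ ^+ _); rewrite invf_div mulrA.
  congr (_ ^+ _); rewrite /p exprS expr_div_n.
  have := exprn_gt0 r nR; have := exprn_gt0 r wR.
  by move: (n%:R ^+ r) (w%:R ^+ r) => a b b0 a0; field; rewrite !gt_eqF.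
- apply: le_trans (Pr_high_degree _ _ _ p01) _; rewrite !card_ord /=.
  have -> : n%:R ^+ r * p = d.
    by rewrite /p mulrCA divff ?mulr1// expf_neq0// gt_eqF.
  have mR : 0 < m%:R :> R by rewrite ltr0n.
  (* [m] is linear in [n] while [d] is fixed, so the base is at most 1/2. *)
  have hm : expR 1 * d / m%:R <= expR (- (1 / 2)).
    rewrite expRN.
    have half : expR (1 / 2) <= 2 :> R.
      by apply: le_trans (expR_le_quad (lexx _)) _; clear; lra.
    apply: le_trans (_ : 2^-1 <= _); last by rewrite lef_pV2 ?posrE ?expR_gt0.
    rewrite ler_pdivrMr// ler_pdivlMl//; apply: le_trans m_lo.
    by move: N3; rewrite ler_pdivrMr ?mulr_gt0//; clear; lra.
  have hm2 : (expR 1 * d / m%:R) ^+ m <= expR (- (3 / 4 * l * n%:R)).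
    apply: le_trans (_ : expR (- (1 / 2)) ^+ m <= _).
      by rewrite lerXn2r ?nnegrE ?expR_ge0// divr_ge0// mulr_ge0 ?expR_ge0 ?ltW.
    by rewrite -expRM_natr ler_expR; clear -m_lo; lra.
  apply: le_trans (ler_wpM2l (ler0n _ _) hm2) _.
  rewrite expRN ler_pdivrMr ?expR_gt0//.
  rewrite -(ler_pM2l nR) mulrA divff ?mul1r ?gt_eqF//.
  apply: le_trans N7; rewrite natrM mulrCA -expr2 ler_wpM2l//.
  by rewrite lerXn2r ?nnegrE// ler_nat.
Qed.

Theorem theorem1p3 (R : realType) (r : nat) (hr : (2 <= r)%N)
    (eps : R) (heps0 : 0 < eps) (heps1 : eps < 1) :
  exists d0 : nat, forall d : R, d0%:R <= d ->
  exists (n0 : nat) (c : R), 0 < c /\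
  forall n : nat, (n0 <= n)%N ->
    let p := d / n%:R ^+ (r - 1)%N in
    let x := ((r%:R - 1) / r%:R * (d / ln d)) `^ (1 / (r%:R - 1)) in
    1 - n%:R `^ (- c) <=
    hypergraph_Pr p (fun H : {set {set 'I_n * 'I_r}} =>
      ((((1 - eps) * x)%:E <= balanced_chromatic_number R (@part r n) H)%E &&
       (balanced_chromatic_number R (@part r n) H <= ((1 + eps) * x)%:E)%E)).
Proof.
case: r hr => [//|r] r1.
have ep01 : 0 < eps < 1 by rewrite heps0.
have [d0 par] := parameters (r1 : (0 < r)%N) ep01.
exists d0 => d dd0.
pose x : R := ((r.+1%:R - 1) / r.+1%:R * (d / ln d)) `^ (1 / (r.+1%:R - 1)).
have [q [D [delta [l [[d0' x0 q0 D0] [de0 l0 l48 l2] hU Hov [Hden Hfree]]]]]] :=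
  par d dd0 x erefl.
have [n0 Hn] := Pr_bad_event_le r1 ep01 d0' x0 q0 D0 de0 l0 l48 l2 Hov Hden Hfree.
(* The failure probability [4 / n] is at most [n^(-1/2)] once [n >= 16]. *)
exists (n0 + 16)%N, (1 / 2); split; first by [].
move=> n nn; cbv zeta; rewrite subn1 /= -/x hypergraph_PrE.
have [|n_0 [k [m [s [k0 /andP[ms sn] hs hL [p01 Pbad]]]]]] := Hn n; first by clear -nn; lia.
rewrite rs_PrC lerD2l lerN2.
apply: le_trans (_ : 4 / n%:R <= _); last first.
  have nR : 0 < n%:R :> R by rewrite ltr0n.
  rewrite powRN mul1r powR12_sqrt ?(ltW nR)//.
  rewrite ler_pdivrMr// -{2}[n%:R]sqr_sqrtr ?(ltW nR)//.
  rewrite expr2 mulrA mulVf ?mul1r; last by rewrite gt_eqF// sqrtr_gt0.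
  rewrite -[leLHS]ger0_norm// -sqrtr_sqr ler_sqrt//.
  by rewrite -natrX ler_nat; clear -nn; lia.
apply: le_trans Pbad; apply: le_rs_Pr => // S; apply: contraR => nbad.
by apply: not_bad_event nbad.
Qed.
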